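(* Let $n\ge 1$. The following statements hold. (i) For every $x\in A_n$, $[\mathrm{id},x]\cong[\mathrm{id},\operatorname{bot}(x)]$ as posets. Thus every lower Bruhat interval in $A_n$ is isomorphic as a poset to a lower Bruhat interval in $B_n$. (ii) For every $x\in A_n$, $P_x(q)=P_{\operatorname{bot}(x)}(q)$. In particular, every Poincaré polynomial in $A_n$ occurs as a Poincaré polynomial in $B_n$. (iii) For every $x,y\in A_n$ with $x\le y$, $P_{x,y}(q)=P_{\operatorname{bot}(x),\operatorname{bot}(y)}(q)$. In particular, every Kazhdan–Lusztig polynomial in $A_n$ occurs in $B_n$.
   Context: $A_n$ is the group of permutations of $\{0,1,\ldots,n\}$, written in one-line notation $x=x_0x_1\cdots x_n$, with simple reflections $s'_0,\ldots,s'_{n-1}$; right multiplication by $s'_i$ interchanges the entries $x_i$ and $x_{i+1}$. $B_n$ is the group of signed permutations $w=w_1\cdots w_n$ (each $w_i\in\{\pm1,\ldots,\pm n\}$ and $\{|w_1|,\ldots,|w_n|\}=\{1,\ldots,n\}$), with simple reflections $s_0,\ldots,s_{n-1}$; right multiplication by $s_i$ ($1\le i\le n-1$) interchanges the entries in positions $i$ and $i+1$, and right multiplication by $s_0$ changes the sign of the first entry. A bar denotes negation. Both groups carry the Bruhat order $\le$ with respect to these generators, with length function $\ell$, and $[\mathrm{id},w]=\{u:u\le w\}$. The bottom map $\operatorname{bot}\colon A_n\to B_n$: for $x=x_0x_1\cdots x_n\in A_n$, delete the first entry $x_0$; if $x_0\ne 0$, replace the remaining entry $0$ by $\overline{x_0}$.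 The resulting signed permutation is $\operatorname{bot}(x)$. For example, $\operatorname{bot}(0231)=231$ and $\operatorname{bot}(2310)=31\overline 2$. The Poincaré polynomial of an element $w$ of a Coxeter group is $P_w(q)=\sum_{u\le w}q^{\ell(u)}$. For $x\le y$, $P_{x,y}(q)$ denotes the Kazhdan–Lusztig polynomial of the pair $(x,y)$ in the corresponding Coxeter group. *)

(* Defs.v *)
From Stdlib Require Import ClassicalEpsilon.
From HB Require Import structures.
From mathcomp Require Import all_boot all_order all_algebra all_fingroup.

Set Implicit Arguments.
Unset Strict Implicit.
Unset Printing Implicit Defensive.

Import GRing.Theory.
Local Open Scope group_scope.

(* A finite Coxeter system is given by a finite group gT and the set S of its
   simple reflections. *)
Section Coxeter.

Variables (gT : finGroupType) (S : {set gT}).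
Implicit Types u v w s t a : gT.

(* The least k such that w is a product of k simple reflections: [S ^+ k] is
   the k-fold product set. A reduced word has length < #|gT|, since its
   prefixes are pairwise distinct elements. *)
Definition ell w : nat := find (fun k => w \in S ^+ k) (iota 0 #|gT|).

Definition reflections : {set gT} := class_support S [set: gT].

Definition bruhat_step : rel gT :=
  fun u v => [exists t in reflections, (v == u * t) && (ell u < ell v)].

Definition bruhat : rel gT := connect bruhat_step.

Definition lower_interval w : {set gT} := [set u | bruhat u w].

Definition poincare w : {poly int} :=
  (\sum_(u in lower_interval w) 'X^(ell u))%R.

Definition right_descent v s := (s \in S) && (ell (v * s) < ell v).

(* The R-polynomials and the Kazhdan-Lusztig polynomials are the unique
   families with the following properties (Bjorner-Brenti, Combinatorics of
   Coxeter groups, Theorems 5.1.1 and 5.1.4). *)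
Definition is_R_family (R : gT -> gT -> {poly int}) : Prop :=
  [/\ forall u v, ~~ bruhat u v -> R u v = 0%R,
      forall u, R u u = 1%R
    & forall u v s, right_descent v s ->
        R u v = if right_descent u s then R (u * s) (v * s)
                else ('X * R (u * s)%g (v * s)%g + ('X - 1) * R u (v * s)%g)%R].

Definition Rpoly : gT -> gT -> {poly int} :=
  epsilon (inhabits (fun _ _ => 0%R)) is_R_family.

(* q^d p(1/q), for p of degree at most d *)
Definition rev_poly (d : nat) (p : {poly int}) : {poly int} :=
  (\poly_(i < d.+1) p`_(d - i))%R.

Definition is_KL_family (P : gT -> gT -> {poly int}) : Prop :=
  [/\ forall u v, ~~ bruhat u v -> P u v = 0%R,
      forall u, P u u = 1%R,
      (* deg P_{u,v} <= (l(v) - l(u) - 1) / 2 *)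
      forall u v, bruhat u v -> u != v ->
        (2 * (size (P u v)).-1 <= (ell v - ell u).-1)%N
    & forall u v, bruhat u v ->
        rev_poly (ell v - ell u) (P u v)
        = (\sum_(a | bruhat u a && bruhat a v) Rpoly u a * P a v)%R].

Definition KLpoly : gT -> gT -> {poly int} :=
  epsilon (inhabits (fun _ _ => 0%R)) is_KL_family.

End Coxeter.

Definition poset_iso (T1 T2 : finType) (le1 : rel T1) (le2 : rel T2)
    (A1 : {set T1}) (A2 : {set T2}) : Prop :=
  exists f : T1 -> T2,
    [/\ {in A1 &, injective f}, f @: A1 = A2
      & {in A1 &, forall u v, le2 (f u) (f v) = le1 u v}].

(* The group A_n. MathComp multiplies permutations from left to right, so
   {perm T} is equipped here with the opposite product: (x * y) i = x (y i),
   for which right multiplication permutes positions. *)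
Definition symA (n : nat) : Type := 'S_n.+1.

Section GroupA.

Variable n : nat.

HB.instance Definition _ := Finite.on (symA n).

Definition wordA (x : symA n) : 'I_n.+1 -> 'I_n.+1 := @fun_of_perm _ x.

Definition mulA (x y : symA n) : symA n := ((y : 'S_n.+1) * (x : 'S_n.+1))%g.
Definition oneA : symA n := (1 : 'S_n.+1)%g.
Definition invA (x : symA n) : symA n := ((x : 'S_n.+1)^-1)%g.

Fact mulA_assoc : associative mulA.
Proof. by move=> x y z; rewrite /mulA mulgA. Qed.
Fact mulA_1 : left_id oneA mulA.
Proof. by move=> x; rewrite /mulA mulg1. Qed.
Fact mulA_V : left_inverse oneA invA mulA.
Proof. by move=> x; rewrite /mulA mulgV. Qed.

HB.instance Definition _ := Finite_isGroup.Build (symA n)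
  mulA_assoc mulA_1 mulA_V.

(* s'_i interchanges i and i + 1, for 0 <= i < n *)
Definition simpleA (i : 'I_n) : symA n :=
  tperm (widen_ord (leqnSn n) i) (lift ord0 i).

Definition gensA : {set symA n} := [set simpleA i | i : 'I_n].

End GroupA.

(* The letter (b, k) is (-1)^b (k + 1), for k < n. *)
Definition letter (n : nat) : Type := (bool * 'I_n)%type.

(* The group B_n: position j of the finite function holds the entry w_{j+1}. *)
Record symB (n : nat) := SymB {
  wordB :> {ffun 'I_n -> letter n};
  wordB_abs : [set (wordB j).2 | j : 'I_n] == [set: 'I_n]
}.

Section GroupB.

Variable n : nat.

HB.instance Definition _ := [isSub for @wordB n].
HB.instance Definition _ := [Finite of symB n by <:].

Implicit Types u v w : symB n.

Fact wordB_inj w : injective (fun j => (w j).2).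
Proof.
have /imset_injP w_inj : #|[set (w j).2 | j : 'I_n]| == #|'I_n|.
  by rewrite (eqP (wordB_abs w)) cardsT.
by move=> i j; apply: w_inj.
Qed.

Fact symB_subproof (f : 'I_n -> letter n) : injective (fun j => (f j).2) ->
  [set ((finfun f) j).2 | j : 'I_n] == [set: 'I_n].
Proof.
move=> f_inj; rewrite eqEcard subsetT /=.
by rewrite card_imset ?cardsT //= => i j; rewrite !ffunE; apply: f_inj.
Qed.

Definition mkB (f : 'I_n -> letter n) f_inj := SymB (@symB_subproof f f_inj).

(* The product is composition of the odd maps on {-n..-1, 1..n} extending the
   words: if v_j = (-1)^b k then (u v)_j = (-1)^b u_k. *)
Definition mulB_word u v : 'I_n -> letter n :=
  fun j => ((v j).1 (+) (u (v j).2).1, (u (v j).2).2).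

Fact mulB_inj u v : injective (fun j => (mulB_word u v j).2).
Proof. by move=> i j /= /wordB_inj /wordB_inj. Qed.

Definition mulB u v : symB n := mkB (@mulB_inj u v).

Fact oneB_inj : injective (fun j : 'I_n => ((false, j) : letter n).2).
Proof. by move=> i j. Qed.

Definition oneB : symB n := mkB oneB_inj.

Definition invB_word w : 'I_n -> letter n :=
  fun k => let j := invF (@wordB_inj w) k in ((w j).1, j).

Fact invB_inj w : injective (fun k => (invB_word w k).2).
Proof. by move=> i j /= /(can_inj (f_invF (@wordB_inj w))). Qed.

Definition invB w : symB n := mkB (@invB_inj w).

Fact mulB_assoc : associative mulB.
Proof.
move=> u v w; apply/val_inj/ffunP => j.
by rewrite !ffunE /mulB_word /= !ffunE /mulB_word /= addbA.
Qed.
Fact mulB_1 : left_id oneB mulB.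
Proof.
move=> w; apply/val_inj/ffunP => j.
by rewrite !ffunE /mulB_word /= !ffunE /= addbF -surjective_pairing.
Qed.
Fact mulB_V : left_inverse oneB invB mulB.
Proof.
move=> w; apply/val_inj/ffunP => j.
by rewrite !ffunE /mulB_word /= !ffunE /invB_word /= invF_f addbb.
Qed.

HB.instance Definition _ := Finite_isGroup.Build (symB n)
  mulB_assoc mulB_1 mulB_V.

(* s_0 changes the sign of 1, and s_i interchanges i and i + 1 for
   1 <= i < n, i.e., the indices i - 1 and i of 'I_n. *)
Definition simpleB_word (i : 'I_n) : 'I_n -> letter n :=
  fun j => if val i == 0%N then (j == i, j)
           else (false, tperm (ord_pred i) i j).

Fact simpleB_inj i : injective (fun j => (simpleB_word i j).2).
Proof.
by rewrite /simpleB_word; case: eqP => _ j k //= /perm_inj.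
Qed.

Definition simpleB (i : 'I_n) : symB n := mkB (@simpleB_inj i).

Definition gensB : {set symB n} := [set simpleB i | i : 'I_n].

(* [lift ord0 j] is the position j + 1, and [unlift ord0 v = Some k] means that
   v = k + 1, while [unlift ord0 v = None] means that v = 0. In the last branch
   x_0 != 0, so the default value j is not used. *)
Definition bot_word (x : symA n) : 'I_n -> letter n :=
  fun j => if unlift ord0 (wordA x (lift ord0 j)) is Some k then (false, k)
           else (true, odflt j (unlift ord0 (wordA x ord0))).

Fact bot_inj x : injective (fun j => (bot_word x j).2).
Proof.
have x_inj : injective (wordA x) by apply: perm_inj.
have x0 j : wordA x (lift ord0 j) = ord0 ->
    exists2 k, unlift ord0 (wordA x ord0) = Some k
             & wordA x ord0 = lift ord0 k.
  move=> xj; case: unliftP => [k -> | xz]; first by exists k.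
  by have /x_inj/eqP := etrans xj (esym xz); rewrite eq_sym (negPf (neq_lift _ _)).
move=> i j; rewrite /bot_word.
case: (unliftP ord0 (wordA x (lift ord0 i))) => [k xi|xi];
case: (unliftP ord0 (wordA x (lift ord0 j))) => [l xj|xj] /=.
- by move=> kl; apply/(@lift_inj _ ord0)/x_inj; rewrite xi xj kl.
- have [m -> xm] := x0 j xj; move=> /= km; move: xi; rewrite km -xm.
  by move/x_inj/eqP; rewrite eq_sym (negPf (neq_lift _ _)).
- have [m -> xm] := x0 i xi; move=> /= ml; move: xj; rewrite -ml -xm.
  by move/x_inj/eqP; rewrite eq_sym (negPf (neq_lift _ _)).
by move=> _; apply/(@lift_inj _ ord0)/x_inj; rewrite xi xj.
Qed.

Definition bot (x : symA n) : symB n := mkB (@bot_inj x).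

End GroupB.

(* Main.v *)
Require Import Defs.
From Stdlib Require Import ClassicalEpsilon.
From HB Require Import structures.
From mathcomp Require Import all_boot all_order all_algebra all_fingroup.
From mathcomp Require Import ring zify.

Set Implicit Arguments.
Unset Strict Implicit.
Unset Printing Implicit Defensive.

Import GRing.Theory.
Local Open Scope group_scope.

(** Some reduced word of [x] uses s'_0 at most once, by decomposing A_n into
    double cosets of the subgroup generated by the other simple reflections.
    The bottom map replaces s'_0 by s_0 in such a word and keeps s'_i as s_i for
    i > 0. The words that use s_0 at most once form a lower ideal of B_n, and on
    such words the relations of A_n and of B_n agree, since they differ only in
    the braid relation between the letters of index 0 and 1, which in either
    group has a side with two letters of index 0. So the map is an isomorphism
    onto a lower ideal that preserves lengths.

    The proof avoids words in favour of descents. Right multiplication by the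
    i-th simple reflection commutes with [bot] and has the same effect on the
    length in both groups as soon as i > 0, or i = 0 and one of the entries in
    positions 0 and 1 is the entry 0 ([bot_mul], [bot_inv]). Every [y != 1] has
    such a descent: if its entries increase from position 1 on, then 0 is among
    the first two entries ([compat_descent]). Induction along these descents
    gives equality of lengths ([ell_bot]); with the lifting property of the
    Bruhat order ([bruhat_rec]) it shows that [bot] preserves and reflects the
    order ([bruhat_bot]) and that its image is a lower set ([bot_lower]), and
    with the recursion for R-polynomials it shows that these are preserved
    ([Rpoly_bot]). When the descent of [y] is at s'_0 and does not commute with
    [bot] at [x], then [x] is not below [y] and [bot x] is not below [bot y],
    because parabolic subgroups are lower sets ([incompat_not_le]). The
    Kazhdan-Lusztig polynomials are determined by the order, the lengths and the
    R-polynomials of a lower interval ([KL_family_unique]), so they are preserved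
    as well.

    R-polynomials and Kazhdan-Lusztig polynomials are given as a choice among
    the families with certain properties, and therefore the existence of such
    families is needed in both groups. It is proved for any finite group whose
    generators carry an inversion cocycle, that is, a description of the
    inversions of [w s] by those of [w]. Strong exchange, the lifting property
    and the commutation of left and right multiplication in the Hecke algebra
    all follow from the cocycle. The R-polynomials are the coordinates of
    products of Hecke generators, which depend only on the product of the
    reduced word because left and right multiplications commute
    ([opDw_indep]). Their matrix is its own inverse up to signs
    ([Rcol_kernel]), which makes the recursive construction of Kazhdan-Lusztig
    polynomials consistent ([KLsol_rev]). The cocycle itself is read off from
    the order of the letters -n, .., -1, 1, .., n, first in B_n ([cocycleB]) and
    then in A_n, embedded in B_(n+1) as the permutations without signs
    ([cocycleA]). *)

(** * Length, strong exchange and the Bruhat order *)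

Section CoxeterTheory.

Variables (gT : finGroupType) (S : {set gT}).
Implicit Types (u v w x y s t : gT) (om : seq gT).

Notation ell := (ell S).
Notation T := (reflections S).
Notation le := (bruhat S).

(** [inv w t] stands for: the reflection [t] is an inversion of [w]. The third
    clause is the cocycle rule N(w s) = s N(w) s + {s} for inversion sets, with
    symmetric difference as sum, and the last one says that only 1 has no
    descent; together they replace a presentation by generators and
    relations. *)
Definition inversion_cocycle (inv : gT -> pred gT) : Prop :=
  [/\ {in S, forall s, s * s = 1},
      {in T, forall t, ~~ inv 1 t},
      forall w, {in S & T, forall s t,
        inv (w * s) t = inv w (t ^ s^-1) (+) (t == s)}
    & forall w, w != 1 -> exists2 s, s \in S & inv w s].

Variable inv : gT -> pred gT.
Hypothesis cox : inversion_cocycle inv.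

Definition prodw om : gT := \prod_(s <- om) s.

Lemma prodw_cat om1 om2 : prodw (om1 ++ om2) = prodw om1 * prodw om2.
Proof. by rewrite /prodw big_cat. Qed.

Lemma prodw_rcons om s : prodw (rcons om s) = prodw om * s.
Proof. by rewrite -cats1 prodw_cat /prodw big_seq1. Qed.

Lemma prodw_cons s om : prodw (s :: om) = s * prodw om.
Proof. by rewrite /prodw big_cons. Qed.

Lemma prodw_nil : prodw [::] = 1.
Proof. by rewrite /prodw big_nil. Qed.

Notation word := (all (mem S)).

Lemma gen_refl s : s \in S -> s \in T.
Proof. by move=> Ss; rewrite mem_class_support. Qed.

Lemma reflJ t x : t \in T -> t ^ x \in T.
Proof.
case/imset2P=> s y Ss _ ->.
by rewrite -conjgM memJ_class_support ?inE.
Qed.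

Lemma mulSS s : s \in S -> s * s = 1.
Proof. by case: cox => + _ _ _; apply. Qed.

Lemma invS s : s \in S -> s^-1 = s.
Proof. by move=> /mulSS ss; apply/eqP; rewrite eq_invg_mul ss. Qed.

Lemma mulSK s x : s \in S -> x * s * s = x.
Proof. by move=> Ss; rewrite -mulgA mulSS ?mulg1. Qed.

Lemma mulKS s x : s \in S -> s * (s * x) = x.
Proof. by move=> Ss; rewrite mulgA mulSS ?mul1g. Qed.

Lemma inv1 t : t \in T -> inv 1 t = false.
Proof. by case: cox => _ i1 _ _ /i1/negbTE. Qed.

Lemma inv_mulS w s t : s \in S -> t \in T ->
  inv (w * s) t = inv w (t ^ s^-1) (+) (t == s).
Proof. by case: cox => _ _ H _; apply: H. Qed.

Lemma has_inv w : w != 1 -> exists2 s, s \in S & inv w s.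
Proof. by case: cox => _ _ _; apply. Qed.

Lemma mulTT t : t \in T -> t * t = 1.
Proof. by case/imset2P=> s x Ss _ ->; rewrite -conjMg mulSS ?conj1g. Qed.

Lemma mulTK t x : t \in T -> x * t * t = x.
Proof. by move=> Tt; rewrite -mulgA mulTT ?mulg1. Qed.

(** Multiplying by a descent removes one inversion, so descending ends at 1. *)
Lemma word_exists w : exists2 om, word om & prodw om = w.
Proof.
have [k] := ubnP #|[set t in T | inv w t]|; elim: k w => // k IHk w wk.
have [-> | w_neq1] := eqVneq w 1; first by exists [::]; rewrite ?prodw_nil.
have [s Ss ws] := has_inv w_neq1.
have [|om om_word om_w] := IHk (w * s).
  apply: leq_trans (_ : #|[set t in T | inv w t]| <= k); last by [].
  have Iws : [set t in T | inv (w * s) t] \subset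
             ([set t in T | inv w t] :^ s) :\ s.
    apply/subsetP=> t; rewrite in_set in_setD1 mem_conjg in_set => /andP[Tt].
    rewrite inv_mulS // reflJ //.
    have [-> | nts] := eqVneq t s; first by rewrite /conjg invgK mulgA mulgK ws.
    by rewrite addbF.
  apply: leq_ltn_trans (subset_leq_card Iws) _.
  rewrite -(cardJg _ s) [in ltnRHS](cardsD1 s) mem_conjg in_set.
  by rewrite /conjg invgK mulgA mulgK gen_refl ?ws.
exists (rcons om s); first by rewrite all_rcons om_word andbT.
by rewrite prodw_rcons om_w mulSK.
Qed.

(** The cocycle rule for arbitrary products, by induction on a word of [y]. *)
Lemma inv_mul x y t : t \in T -> inv (x * y) t = inv y t (+) inv x (t ^ y^-1).
Proof.
have [om + <-] := word_exists y.
elim/last_ind: om t => [|om s IHom] t.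
  by rewrite prodw_nil mulg1 invg1 conjg1 => _ /inv1->.
rewrite all_rcons prodw_rcons => /andP[Ss om_word] Tt.
rewrite mulgA !(@inv_mulS _ s) // IHom ?reflJ // invMg conjgM.
by rewrite -!addbA; congr addb; rewrite addbC.
Qed.

(** Writing [t] as a conjugate of [s], the contributions of the two conjugating
    factors cancel and that of [s] remains. *)
Lemma inv_refl t : t \in T -> inv t t.
Proof.
case/imset2P=> s x Ss _ ->; have Ts := gen_refl Ss; have Tsx := reflJ x Ts.
have: inv (x^-1 * x) (s ^ x) = false by rewrite mulVg inv1.
rewrite {2}/conjg !inv_mul // ?invMg ?invgK ?conjgM ?reflJ // !conjgK.
have -> : s ^ s^-1 = s by rewrite /conjg invgK mulgA mulgK.
have -> : inv s s by rewrite -[s in inv s _]mul1g inv_mulS // inv1 ?reflJ ?eqxx.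
by move=> /negbT; rewrite negb_add => /eqP ->; case: inv.
Qed.

(** If [t] is an inversion of a product, it is one of the partial conjugates
    occurring in the cocycle sum, and then [t] cancels the matching letter. *)
Lemma strong_exchange om t : word om -> t \in T -> inv (prodw om) t ->
  exists om1 s om2, om = om1 ++ s :: om2 /\ prodw om * t = prodw (om1 ++ om2).
Proof.
elim/last_ind: om t => [|om s IHom] t; first by rewrite prodw_nil => _ /inv1->.
rewrite all_rcons prodw_rcons => /andP[Ss om_word] Tt; rewrite inv_mulS //.
have [-> _ | nts] := eqVneq t s.
  by exists om, s, [::]; rewrite cats1 cats0 mulSK.
rewrite addbF => /(IHom _ om_word (reflJ _ Tt))[om1 [r [om2 [-> eq_om]]]].
exists om1, r, (rcons om2 s); rewrite -rcons_cons -rcons_cat; split=> //.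
by rewrite -rcons_cat prodw_rcons -eq_om /conjg invgK !mulgA mulgKV.
Qed.

Lemma word_expg w k :
  reflect (exists2 om, word om & prodw om = w /\ size om = k) (w \in S ^+ k).
Proof.
apply: (iffP idP) => [|[om om_word [<- <-]]].
  elim: k w => [|k IHk] w.
    by rewrite expg0 => /set1P->; exists [::]; rewrite ?prodw_nil.
  rewrite expgSr => /mulsgP[x s /IHk[om om_word [<- <-]] Ss ->].
  exists (rcons om s); first by rewrite all_rcons om_word andbT.
  by rewrite prodw_rcons size_rcons.
elim: om om_word => [|s om IHom] /=; first by rewrite prodw_nil expg0 inE.
by case/andP=> Ss om_word; rewrite prodw_cons expgS mem_mulg ?IHom.
Qed.

Definition reduced om := word om && (size om == ell (prodw om)).

(* [len] is the length defined without the bound on the exponent that occurs in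
   the definition of [ell]; this bound is never reached ([len_lt]). *)
Let len_ex w : exists k, w \in S ^+ k.
Proof.
by have [om om_word om_w] := word_exists w; exists (size om); apply/word_expg; exists om.
Qed.

Let len w := ex_minn (len_ex w).

Let len_le om : word om -> len (prodw om) <= size om.
Proof.
move=> om_word; rewrite /len; case: ex_minnP => k _; apply.
by apply/word_expg; exists om.
Qed.

Let len_word w : exists2 om, word om & prodw om = w /\ size om = len w.
Proof. by rewrite /len; case: ex_minnP => k /word_expg. Qed.

(** A prefix of a shortest word is a shortest word. *)
Let len_prefix w k : k <= len w -> exists x, len x = k.
Proof.
have [om om_word [om_w om_len]] := len_word w; rewrite -om_len => le_k.
exists (prodw (take k om)); apply/eqP; rewrite eqn_leq.
move: om_word; rewrite -{1}(cat_take_drop k om) all_cat => /andP[w1 w2].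
have sz1: size (take k om) = k by rewrite size_takel.
rewrite -{2}sz1 len_le //=.
have [om' om'_word [om'_w om'_len]] := len_word (prodw (take k om)).
rewrite -om'_len -(leq_add2r (size (drop k om))) -size_cat size_drop subnKC //.
rewrite om_len -om_w -{1}(cat_take_drop k om) prodw_cat -om'_w -prodw_cat.
by rewrite len_le // all_cat om'_word.
Qed.

(** All lengths up to that of [w] are taken, so there are as many elements. *)
Let len_lt w : len w < #|gT|.
Proof.
have /fin_all_exists[f f_len] (i : 'I_(len w).+1) : exists x, len x = i.
  by apply: (@len_prefix w); rewrite -ltnS.
rewrite -[X in X <= _]card_ord; apply: (@leq_card _ _ f) => i j eq_f.
by apply: val_inj; rewrite /= -!f_len eq_f.
Qed.

Let ell_len w : ell w = len w.
Proof.
have [om om_word [om_w om_len]] := len_word w.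
rewrite /Defs.ell; apply/eqP; rewrite eqn_leq; apply/andP; split.
  rewrite leqNgt; apply/negP => /(before_find 0); rewrite nth_iota // add0n => /negP[].
  by apply/word_expg; exists om.
rewrite /len; case: ex_minnP => k wk k_min; apply: k_min.
have has_w: has (fun k => w \in S ^+ k) (iota 0 #|gT|).
  apply/hasP; exists (len w); first by rewrite mem_iota len_lt.
  by apply/word_expg; exists om.
have := nth_find 0 has_w; rewrite nth_iota ?add0n //.
by rewrite -[X in _ < X](size_iota 0) -has_find.
Qed.

Lemma ell_le om : word om -> ell (prodw om) <= size om.
Proof. by rewrite ell_len; apply: len_le. Qed.

Lemma reduced_exists w : exists om, reduced om && (prodw om == w).
Proof.
have [om om_word [om_w om_len]] := len_word w.
by exists om; rewrite /reduced om_word om_w ell_len om_len !eqxx.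
Qed.

Lemma ell1 : ell 1 = 0.
Proof. by apply/eqP; rewrite -leqn0 -prodw_nil ell_le. Qed.

Lemma ell_inv_lt w t : t \in T -> inv w t -> ell (w * t) < ell w.
Proof.
have [om /andP[/andP[om_word /eqP sz] /eqP <-]] := reduced_exists w => Tt it.
have [om1 [s [om2 [eq_om ->]]]] := strong_exchange om_word Tt it.
rewrite -sz eq_om; apply: leq_ltn_trans (ell_le _) _.
  by move: om_word; rewrite eq_om !all_cat /= => /and3P[-> _ ->].
by rewrite !size_cat /= addnS.
Qed.

Lemma inv_mulT w t : t \in T -> inv (w * t) t = ~~ inv w t.
Proof.
by move=> Tt; rewrite inv_mul // inv_refl // /conjg invgK mulgA mulgK addTb.
Qed.

(** If [t] is no inversion of [w], then it is one of [w t], and strong exchange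
    shortens [w t] instead. *)
Lemma ell_mulT w t : t \in T -> (ell (w * t) < ell w) = inv w t.
Proof.
move=> Tt; have [/ell_inv_lt->// | nit] := boolP (inv w t).
have := @ell_inv_lt (w * t) t Tt; rewrite inv_mulT // mulTK // => /(_ nit).
by move=> lt_w; rewrite ltnNge ltnW.
Qed.

Lemma ell_mulS_le w s : s \in S -> ell (w * s) <= (ell w).+1.
Proof.
have [om /andP[/andP[om_word /eqP sz] /eqP <-]] := reduced_exists w => Ss.
by rewrite -sz -prodw_rcons -(size_rcons om s) ell_le // all_rcons om_word andbT.
Qed.

Lemma ell_descent w s : s \in S -> inv w s -> ell w = (ell (w * s)).+1.
Proof.
move=> Ss; rewrite -ell_mulT ?gen_refl // => lt_w; apply/eqP; rewrite eqn_leq lt_w.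
by rewrite -{1}(mulSK w Ss) ell_mulS_le.
Qed.

Lemma ell_ascent w s : s \in S -> ~~ inv w s -> ell (w * s) = (ell w).+1.
Proof.
move=> Ss nis; rewrite (ell_descent Ss) ?mulSK //.
by rewrite inv_mulT ?gen_refl.
Qed.

Lemma odd_ell_word om : word om -> odd (ell (prodw om)) = odd (size om).
Proof.
elim/last_ind: om => [|om s IHom]; first by rewrite prodw_nil ell1.
rewrite all_rcons prodw_rcons size_rcons /= => /andP[Ss /IHom <-].
have [/(ell_descent Ss)->|/(ell_ascent Ss)->//] := boolP (inv (prodw om) s).
by rewrite /= negbK.
Qed.

Lemma odd_ell_mulT w t : t \in T -> odd (ell (w * t)) = ~~ odd (ell w).
Proof.
move=> Tt; wlog it: w / inv w t.
  move=> IH; have [/IH // | nit] := boolP (inv w t).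
  by have := IH (w * t); rewrite inv_mulT // mulTK // => /(_ nit)->; rewrite negbK.
have [om om_word om_w] := word_exists w; rewrite -om_w in it *.
have [om1 [s [om2 [eq_om ->]]]] := strong_exchange om_word Tt it.
have om12_word : word (om1 ++ om2).
  by move: om_word; rewrite eq_om !all_cat /= => /and3P[-> _ ->].
by rewrite !odd_ell_word // eq_om !size_cat addnS /= negbK.
Qed.

Lemma prodw_rev om : word om -> prodw (rev om) = (prodw om)^-1.
Proof.
elim: om => [|s om IHom] /=; first by rewrite prodw_nil invg1.
case/andP=> Ss /IHom IH.
by rewrite prodw_cons rev_cons prodw_rcons invMg IH (invS Ss).
Qed.

Lemma ell_invg w : ell w^-1 = ell w.
Proof.
wlog suff: w / ell w^-1 <= ell w.
  by move=> IH; apply/eqP; rewrite eqn_leq IH -{1}(invgK w) IH.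
have [om /andP[/andP[om_word /eqP sz] /eqP <-]] := reduced_exists w.
by rewrite -sz -size_rev -prodw_rev // ell_le ?all_rev.
Qed.

Lemma bruhat_refl u : le u u.
Proof. exact: connect0. Qed.

Lemma bruhat_trans u v w : le u v -> le v w -> le u w.
Proof. exact: connect_trans. Qed.

Lemma bruhat_mulT w t : t \in T -> inv w t -> le (w * t) w.
Proof.
move=> Tt it; apply/connect1/exists_inP; exists t => //.
by rewrite mulTK // eqxx ell_mulT.
Qed.

(** Induction along a chain of reflections, read from the top. *)
Lemma bruhat_ind_r (P : gT -> Prop) v :
  P v -> (forall x t, t \in T -> inv x t -> le x v -> P x -> P (x * t)) ->
  forall u, le u v -> P u.
Proof.
move=> Pv Pstep u /connectP[p]; elim: p u => [|x p IHp] u /=; first by move=> _ <-.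
case/andP=> /exists_inP[t Tt /andP[/eqP x_def lt_ux]] px v_def.
have Px := IHp _ px v_def; rewrite -(mulTK u Tt) -x_def; apply: Pstep => //.
  by rewrite -ell_mulT // x_def mulTK // -x_def.
by apply/connectP; exists p.
Qed.

Lemma bruhat_ell u v : le u v -> u = v \/ ell u < ell v.
Proof.
move: u; apply: bruhat_ind_r => [|x t Tt it _]; first by left.
by have:= ell_inv_lt Tt it => lt_x [<-|lt_v]; right=> //; apply: ltn_trans lt_v.
Qed.

Lemma bruhat_ell_le u v : le u v -> ell u <= ell v.
Proof. by case/bruhat_ell => [->|/ltnW]. Qed.

Lemma bruhat_anti u v : le u v -> le v u -> u = v.
Proof. by case/bruhat_ell => // lt_uv /bruhat_ell_le; rewrite leqNgt lt_uv. Qed.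

(** A reflection step [x > x t] is either the step along [s] itself or is
    carried by right multiplication to the step [x s > x t s]: the cocycle
    transports the inversion [t] of [x] to the inversion [t ^ s] of [x s]. *)
Lemma bruhat_step_mulS x t s : s \in S -> t \in T -> inv x t ->
  t = s \/ le (x * t * s) (x * s).
Proof.
move=> Ss Tt it; have [-> | nts] := eqVneq t s; [by left | right].
have -> : x * t * s = x * s * (t ^ s) by rewrite /conjg !mulgA mulgK.
apply: bruhat_mulT; first exact: reflJ.
rewrite inv_mulS ?reflJ // conjgK it (_ : (t ^ s == s) = false) //.
apply: contra_neqF nts => /eqP eq_s; apply: (@conjg_inj _ s).
by rewrite eq_s /conjg mulgA mulVg mul1g.
Qed.

Lemma bruhat_descent u s : s \in S -> inv u s -> le (u * s) u.
Proof. by move=> Ss; apply/bruhat_mulT/gen_refl. Qed.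

Lemma bruhat_ascent u s : s \in S -> ~~ inv u s -> le u (u * s).
Proof.
move=> Ss nis; rewrite -{1}(mulSK u Ss); apply: bruhat_descent => //.
by rewrite inv_mulT ?gen_refl.
Qed.

Definition up u s := if inv u s then u else u * s.

(** Together with [bruhat_down] this is the lifting property. *)
Lemma bruhat_up u v s : s \in S -> le u v -> le (up u s) (up v s).
Proof.
move=> Ss; move: u; apply: bruhat_ind_r => [|x t Tt it _]; first exact: bruhat_refl.
apply: bruhat_trans; rewrite /up.
have Ts := gen_refl Ss; have le_xt := bruhat_mulT Tt it.
have [Dxt | Uxt] := boolP (inv (x * t) s); have [Dx | Ux] := boolP (inv x s) => //.
- by apply: bruhat_trans le_xt (bruhat_ascent _ _).
- have [-> | le_xts] := bruhat_step_mulS Ss Tt it; first by rewrite mulSK ?bruhat_refl.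
  exact: bruhat_trans le_xts (bruhat_descent Ss Dx).
have [eq_ts | //] := bruhat_step_mulS Ss Tt it.
by rewrite eq_ts (negPf Ux) in it.
Qed.

Definition down u s := if inv u s then u * s else u.

Lemma bruhat_down u v s : s \in S -> le u v -> le (down u s) (down v s).
Proof.
move=> Ss; move: u; apply: bruhat_ind_r => [|x t Tt it _]; first exact: bruhat_refl.
apply: bruhat_trans; rewrite /down.
have Ts := gen_refl Ss; have le_xt := bruhat_mulT Tt it.
have [Dxt | Uxt] := boolP (inv (x * t) s); have [Dx | Ux] := boolP (inv x s) => //.
- have [eq_ts | //] := bruhat_step_mulS Ss Tt it.
  by move: Dxt; rewrite eq_ts inv_mulT // Dx.
- exact: bruhat_trans (bruhat_descent Ss Dxt) le_xt.
have [-> | le_xts] := bruhat_step_mulS Ss Tt it; first exact: bruhat_refl.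
exact: bruhat_trans (bruhat_ascent Ss Uxt) le_xts.
Qed.

(** One direction is [bruhat_down]; conversely [bruhat_up] recovers [v] from
    [v s]. *)
Lemma bruhat_rec u v s : s \in S -> inv v s -> le u v = le (down u s) (v * s).
Proof.
move=> Ss Dv; apply/idP/idP => [/(bruhat_down Ss)|le_d].
  by rewrite {2}/down Dv.
have := bruhat_up Ss le_d.
rewrite /up inv_mulT ?gen_refl // Dv mulSK //; apply: bruhat_trans.
rewrite /down; have [Du | Uu] := boolP (inv u s).
  by rewrite inv_mulT ?gen_refl // Du mulSK ?bruhat_refl.
by rewrite (negPf Uu) bruhat_ascent.
Qed.

Lemma bruhat1r u : le u 1 = (u == 1).
Proof.
apply/idP/eqP => [/bruhat_ell[]//|->]; last exact: bruhat_refl.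
by rewrite ell1.
Qed.

(** Strong exchange deletes a letter of a word, hence stays in any subgroup
    generated by simple reflections. *)
Lemma bruhat_parabolic (J : {set gT}) u v :
  J \subset S -> v \in <<J>> -> le u v -> u \in <<J>>.
Proof.
move=> sJS Jv; move: u; apply: bruhat_ind_r => // x t Tt it _ Jx.
have [om + om_x] : exists2 om, all (mem J) om & prodw om = x.
  have /gen_prodgP[k [c Jc ->]] := Jx.
  exists [seq c i | i <- index_enum 'I_k]; first by apply/allP => _ /mapP[i _ ->]; apply: Jc.
  by rewrite /prodw big_map.
rewrite -om_x in it * => J_om; have S_om : word om.
  by apply/allP => s /(allP J_om); apply: (subsetP sJS).
have [om1 [s [om2 [eq_om ->]]]] := strong_exchange S_om Tt it.
rewrite /prodw big_seq; apply: group_prod => r r_om.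
apply/mem_gen/(allP J_om); rewrite eq_om mem_cat inE.
by move: r_om; rewrite mem_cat => /orP[->|->]; rewrite ?orbT.
Qed.

(** Inversions on the left: for a simple [t] this says that [t w] is shorter
    than [w]. *)
Definition linv w t := inv w^-1 t.

Lemma ell_left_descent w s : s \in S -> linv w s -> ell w = (ell (s * w)).+1.
Proof.
by move=> Ss /(ell_descent Ss); rewrite ell_invg -[X in _ * X](invS Ss) -invMg ell_invg.
Qed.

Lemma ell_left_ascent w s : s \in S -> ~~ linv w s -> ell (s * w) = (ell w).+1.
Proof.
by move=> Ss /(ell_ascent Ss); rewrite ell_invg -[X in _ * X](invS Ss) -invMg ell_invg.
Qed.

(** The cocycle shows that right multiplication by [s] changes the left descent
    at [t] only if [t w = w s]. *)
Lemma linv_mulr w s t : s \in S -> t \in S ->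
  linv (w * s) t = linv w t (+) (w * s == t * w).
Proof.
move=> Ss St; have Tt := gen_refl St; rewrite /linv invMg inv_mul //.
congr addb; rewrite invgK -[s^-1]mul1g invS // inv_mulS ?reflJ // inv1 ?reflJ //=.
by rewrite /conjg -(inj_eq (mulgI w)) mulKVg eq_sym.
Qed.

Lemma inv_mull w s t : s \in S -> t \in S ->
  inv (t * w) s = inv w s (+) (w * s == t * w).
Proof.
move=> Ss St; have Ts := gen_refl Ss; rewrite inv_mul //; congr addb.
rewrite -[t in inv t]mul1g inv_mulS ?reflJ // inv1 ?reflJ //=.
by rewrite /conjg invgK mulgA -(inj_eq (mulIg w)) mulgKV.
Qed.

(** Both sides say that the element [w s = t w] is shorter than [w]. *)
Lemma linv_inv w s t : s \in S -> t \in S -> w * s = t * w ->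
  linv w t = inv w s.
Proof.
move=> Ss St eq_w; have [Dw | Uw] := boolP (inv w s).
  apply: contraT => Uwt; have := ell_left_ascent St Uwt.
  by rewrite -eq_w (ell_descent Ss Dw) => /eqP; rewrite -addn2 -[X in X == _]addn0 eqn_add2l.
apply/negbTE/negP => Dwt; have := ell_left_descent St Dwt.
by rewrite -eq_w (ell_ascent Ss Uw) => /eqP; rewrite -addn2 -[X in X == _]addn0 eqn_add2l.
Qed.

Local Open Scope ring_scope.

(** * Hecke operators and R-polynomials *)

Notation V := {ffun gT -> {poly int}^o}.

Lemma scale_regE (a : {poly int}) (b : {poly int}^o) : a *: b = a * b.
Proof. by []. Qed.

Definition delta w : V := [ffun u => (u == w)%:R].

(** In the Hecke algebra with basis (T_w), a function [g] stands for the element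
    with coordinates g(w) in the basis with members T_w multiplied by the sign
    of w. In these coordinates [opT s] is right multiplication by - T_s, and
    [opTl t] is left multiplication by - T_t. *)
Definition opT s (g : V) : V :=
  [ffun u => if inv u s then g (u * s)%g - ('X - 1) * g u else 'X * g (u * s)%g].

Definition opTl t (g : V) : V :=
  [ffun u => if linv u t then g (t * u)%g - ('X - 1) * g u else 'X * g (t * u)%g].

(** This is q times the inverse of [opT s], see [opT_opD]; its coordinates are
    those of the recursion for R-polynomials ([opDE]). *)
Definition opD s (g : V) : V := opT s g + ('X - 1) *: g.

Lemma opDE s g u : opD s g u =
  if inv u s then g (u * s)%g else 'X * g (u * s)%g + ('X - 1) * g u.
Proof.
rewrite /opD !ffunE scale_regE; case: inv => //.
by rewrite subrK.
Qed.

Lemma inv_mulgS w s : s \in S -> inv (w * s)%g s = ~~ inv w s.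
Proof. by move=> Ss; rewrite inv_mulT ?gen_refl. Qed.

Lemma linv_mulgS w t : t \in S -> linv (t * w)%g t = ~~ linv w t.
Proof. by move=> St; rewrite /linv invMg (invS St) inv_mulgS. Qed.

(** The coordinates at [u] involve [u], [u s], [t u] and [t u s] only. The two
    descent conditions are independent unless [u s = t u], and in this case they
    are equal. *)
Lemma opT_opTl s t g : s \in S -> t \in S -> opT s (opTl t g) = opTl t (opT s g).
Proof.
move=> Ss St; apply/ffunP => u; rewrite !ffunE.
rewrite linv_mulr // inv_mull // -!mulgA.
have [eq_u | neq_u] /= := eqVneq (u * s)%g (t * u)%g; last first.
  by rewrite !addbF; case: (inv u s); case: (linv u t); ring.
by rewrite (linv_inv Ss St eq_u) !addbT eq_u mulKS.
Qed.

Lemma opT_opT s g : s \in S -> opT s (opT s g) = 'X *: g - ('X - 1) *: opT s g.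
Proof.
move=> Ss; apply/ffunP => u; rewrite !ffunE !scale_regE inv_mulgS // mulSK //.
by case: (inv u s) => /=; ring.
Qed.

(** On the way up the basis is permuted, so that applying the letters of a
    reduced word to [delta 1] gives a basis vector without any choice. *)
Lemma opT_delta w s : s \in S -> ~~ inv w s -> opT s (delta w) = delta (w * s)%g.
Proof.
move=> Ss nis; apply/ffunP => u; rewrite !ffunE.
have -> : (u * s == w)%g = (u == w * s)%g.
  by rewrite -(inj_eq (mulIg s)) mulSK.
have [-> | neq] := eqVneq u (w * s)%g.
  rewrite inv_mulgS // nis (_ : (w * s == w)%g = false) ?mulr0 ?subr0 //.
  by apply/eqP => eq_w; have := inv_mulgS w Ss; rewrite eq_w; case: inv.
case: ifP => Du; last by rewrite mulr0.
have [eq_u | _] := eqVneq u w; last by rewrite mulr0 subr0.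
by rewrite -eq_u Du in nis.
Qed.

Lemma opTl_delta w t : t \in S -> ~~ linv w t -> opTl t (delta w) = delta (t * w)%g.
Proof.
move=> St nit; apply/ffunP => u; rewrite !ffunE.
have -> : (t * u == w)%g = (u == t * w)%g.
  by rewrite -(inj_eq (mulgI t)) mulKS.
have [-> | neq] := eqVneq u (t * w)%g.
  rewrite linv_mulgS // nit (_ : (t * w == w)%g = false) ?mulr0 ?subr0 //.
  by apply/eqP => eq_w; have := linv_mulgS w St; rewrite eq_w; case: linv.
case: ifP => Du; last by rewrite mulr0.
have [eq_u | _] := eqVneq u w; last by rewrite mulr0 subr0.
by rewrite -eq_u Du in nit.
Qed.

Definition lin (F : V -> V) := forall a g h, F (a *: g + h) = a *: F g + F h.

Lemma lin0 F : lin F -> F 0 = 0.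
Proof.
move=> linF; have:= linF 1 0 0.
by rewrite !scale1r addr0 -{1}[F 0]addr0 => /addrI.
Qed.

Lemma lin_scale F a g : lin F -> F (a *: g) = a *: F g.
Proof. by move=> linF; rewrite -[a *: g]addr0 linF lin0 ?addr0. Qed.

Lemma lin_sum F (I : Type) (r : seq I) (a : I -> {poly int}) (g : I -> V) : lin F ->
  F (\sum_(i <- r) a i *: g i) = \sum_(i <- r) a i *: F (g i).
Proof.
by move=> linF; elim/big_rec2: _ => [|i h1 h2 _ <-]; [exact: lin0 | exact: linF].
Qed.

Lemma lin_opT s : lin (opT s).
Proof.
move=> a g h; apply/ffunP => u; rewrite !ffunE !scale_regE.
by case: inv => /=; ring.
Qed.

Lemma lin_opD s : lin (opD s).
Proof.
move=> a g h; rewrite /opD lin_opT; apply/ffunP => u; rewrite !ffunE !scale_regE.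
by case: inv => /=; ring.
Qed.

Lemma left_descent_exists w : w != 1%g ->
  exists2 t, t \in S & exists2 w', w = (t * w')%g & ~~ linv w' t.
Proof.
rewrite -eq_invg1 => /has_inv[t St iw]; exists t => //; exists (t * w)%g.
  by rewrite mulKS.
by rewrite linv_mulgS // negbK.
Qed.

(** Left multiplications generate all basis vectors from [delta 1], so an
    operator that commutes with them is determined by its value there. *)
Lemma lin_comm_ext (F G : V -> V) : lin F -> lin G ->
  (forall t g, t \in S -> F (opTl t g) = opTl t (F g)) ->
  (forall t g, t \in S -> G (opTl t g) = opTl t (G g)) ->
  F (delta 1%g) = G (delta 1%g) -> F =1 G.
Proof.
move=> linF linG FT GT eq1.
have eqw w : F (delta w) = G (delta w).
  have [k] := ubnP (ell w); elim: k w => // k IHk w lt_k.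
  have [-> // | /left_descent_exists[t St [w' def_w nit]]] := eqVneq w 1%g.
  rewrite def_w -opTl_delta // FT // GT // IHk //.
  by rewrite -ltnS -(ell_left_ascent St nit) -def_w.
move=> g; have -> : g = \sum_w g w *: delta w.
  apply/ffunP => u; rewrite sum_ffunE (bigD1 u) //= big1 => [|w neq_w].
    by rewrite !ffunE eqxx scale_regE mulr1 addr0.
  by rewrite !ffunE eq_sym (negPf neq_w) scaler0.
by rewrite !lin_sum //; apply: eq_bigr => w _; rewrite eqw.
Qed.

Definition opTw om g := foldl (fun g s => opT s g) g om.
Definition opDw om g := foldl (fun g s => opD s g) g om.

Lemma lin_opTw om : lin (opTw om).
Proof. by move=> a g h; elim: om g h => //= s om IHom g h; rewrite lin_opT IHom. Qed.

Lemma lin_opDw om : lin (opDw om).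
Proof. by move=> a g h; elim: om g h => //= s om IHom g h; rewrite lin_opD IHom. Qed.

Lemma opTw_opTl om t g : word om -> t \in S -> opTw om (opTl t g) = opTl t (opTw om g).
Proof.
move=> + St; elim: om g => //= s om IHom g /andP[Ss om_word].
by rewrite opT_opTl // IHom.
Qed.

Lemma reduced_rcons om s : s \in S ->
  reduced (rcons om s) = reduced om && ~~ inv (prodw om) s.
Proof.
move=> Ss; rewrite /reduced all_rcons prodw_rcons size_rcons /= Ss /=.
have [om_word|//] /= := boolP (word om).
have le_om := ell_le om_word.
have [Dom | Uom] := boolP (inv (prodw om) s).
  rewrite andbF; apply/negbTE; rewrite neq_ltn orbC.
  by rewrite ltnS (leq_trans _ le_om) // (ell_descent Ss Dom) leqnSn.
by rewrite ell_ascent // eqSS andbT.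
Qed.

Lemma reduced_rev om : reduced om -> reduced (rev om).
Proof.
case/andP=> om_word om_sz.
by rewrite /reduced all_rev om_word size_rev prodw_rev ?ell_invg.
Qed.

Lemma opTw_delta om : reduced om -> opTw om (delta 1%g) = delta (prodw om).
Proof.
elim/last_ind: om => [|om s IHom]; first by rewrite prodw_nil.
move=> om_red; have Ss : s \in S.
  by move: om_red; rewrite /reduced all_rcons => /andP[/andP[]].
move: om_red; rewrite reduced_rcons // => /andP[/IHom + Uom].
by rewrite /opTw foldl_rcons => ->; rewrite opT_delta // prodw_rcons.
Qed.

(** Two reduced words of [w] both send [delta 1] to [delta w]. *)
Lemma opTw_indep om1 om2 : reduced om1 -> reduced om2 ->
  prodw om1 = prodw om2 -> opTw om1 =1 opTw om2.
Proof.
move=> red1 red2 eq_w; have [/andP[w1 _] /andP[w2 _]] := (red1, red2).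
apply: lin_comm_ext => [||t g St|t g St|]; [exact: lin_opTw | exact: lin_opTw | | |].
- exact: opTw_opTl.
- exact: opTw_opTl.
by rewrite !opTw_delta ?eq_w.
Qed.

Lemma opT_opD s g : s \in S -> opT s (opD s g) = 'X *: g.
Proof.
move=> Ss; rewrite /opD addrC lin_opT opT_opT //.
by rewrite addrC subrK.
Qed.

Lemma opD_opT s g : s \in S -> opD s (opT s g) = 'X *: g.
Proof. by move=> Ss; rewrite /opD opT_opT // subrK. Qed.

Lemma opTw_opDw om g : word om -> opTw (rev om) (opDw om g) = 'X^(size om) *: g.
Proof.
elim/last_ind: om => [|om s IHom]; first by rewrite scale1r.
rewrite all_rcons => /andP[Ss /IHom{}IHom].
rewrite rev_rcons /opDw foldl_rcons /= opT_opD // lin_scale; last exact: lin_opTw.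
by rewrite IHom size_rcons exprS scalerA.
Qed.

Lemma opDw_opTw om g : word om -> opDw om (opTw (rev om) g) = 'X^(size om) *: g.
Proof.
elim: om => [|s om IHom] /=; first by rewrite scale1r.
case/andP=> Ss /IHom{}IHom; rewrite rev_cons /opTw foldl_rcons opD_opT //.
by rewrite lin_scale ?IHom ?scalerA -?exprS //; apply: lin_opDw.
Qed.

(** The operators [opDw] are inverse to the [opTw] of the reversed words up to a
    power of q, which can be cancelled. *)
Lemma opDw_indep om1 om2 g : reduced om1 -> reduced om2 ->
  prodw om1 = prodw om2 -> opDw om1 g = opDw om2 g.
Proof.
move=> red1 red2 eq_w; have [/andP[w1 /eqP s1] /andP[w2 /eqP s2]] := (red1, red2).
have eqT : opTw (rev om1) =1 opTw (rev om2).
  by apply: opTw_indep; rewrite ?reduced_rev ?prodw_rev // eq_w.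
have := opDw_opTw (opDw om2 g) w1; rewrite eqT opTw_opDw // lin_scale; last exact: lin_opDw.
rewrite s1 s2 eq_w => /ffunP eq_g; apply/ffunP => u.
have := eq_g u; rewrite !ffunE !scale_regE; apply: mulfI.
by rewrite expf_neq0 // polyX_eq0.
Qed.

Definition redword w := xchoose (reduced_exists w).

Lemma redwordP w : reduced (redword w) /\ prodw (redword w) = w.
Proof. by have /andP[red_w /eqP] := xchooseP (reduced_exists w). Qed.

(** The value of [Rcol v] at [u] will be the R-polynomial of the pair
    (u, v). *)
Definition Rcol v := opDw (redword v) (delta 1%g).

Lemma Rcol1 : Rcol 1%g = delta 1%g.
Proof.
have [/andP[_ /eqP] + red1] := redwordP 1%g; rewrite /Rcol red1 ell1.
by move=> /size0nil->.
Qed.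

Lemma Rcol_rec v s : s \in S -> inv v s -> Rcol v = opD s (Rcol (v * s)%g).
Proof.
move=> Ss Dv; have [red_v def_v] := redwordP v.
have [red_vs def_vs] := redwordP (v * s)%g.
rewrite /Rcol (@opDw_indep _ (rcons (redword (v * s)%g) s)) //.
- by rewrite /opDw foldl_rcons.
- by rewrite reduced_rcons // red_vs def_vs inv_mulgS // Dv.
by rewrite prodw_rcons def_vs mulSK.
Qed.

Lemma descent_ind (P : gT -> Prop) : P 1%g ->
  (forall v s, s \in S -> inv v s -> P (v * s)%g -> P v) -> forall v, P v.
Proof.
move=> P1 Pstep v; have [k] := ubnP (ell v); elim: k v => // k IHk v lt_k.
have [-> // | /has_inv[s Ss Dv]] := eqVneq v 1%g.
by apply: (Pstep _ _ Ss Dv); apply: IHk; rewrite -ltnS -(ell_descent Ss Dv).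
Qed.

(** By the lifting property, the recursion refers only to pairs whose
    comparability implies [u <= v]. *)
Lemma Rcol_supp v u : ~~ le u v -> Rcol v u = 0.
Proof.
elim/descent_ind: v u => [|v s Ss Dv IHv] u.
  by rewrite bruhat1r Rcol1 ffunE => /negbTE->.
rewrite (bruhat_rec u Ss Dv) (Rcol_rec Ss Dv) opDE /down.
case: ifP => [_ /IHv // | /negbT Uu nle_u].
rewrite !IHv ?mulr0 ?addr0 //.
by apply: contra nle_u; apply/bruhat_trans/bruhat_ascent.
Qed.

Lemma Rcol_diag v : Rcol v v = 1.
Proof.
elim/descent_ind: v => [|v s Ss Dv IHv]; first by rewrite Rcol1 ffunE eqxx.
by rewrite (Rcol_rec Ss Dv) opDE Dv.
Qed.

Lemma right_descentE v s : right_descent S v s = (s \in S) && inv v s.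
Proof.
by rewrite /right_descent; have [Ss /=|//] := boolP (s \in S); rewrite ell_mulT ?gen_refl.
Qed.

Lemma Rcol_family : is_R_family S (fun u v => Rcol v u).
Proof.
split=> [u v | v | u v s]; [exact: Rcol_supp | exact: Rcol_diag |].
rewrite !right_descentE => /andP[Ss Dv].
by rewrite (Rcol_rec Ss Dv) opDE Ss.
Qed.

Lemma Rpoly_family : is_R_family S (Rpoly S).
Proof. by apply: epsilon_spec; exists (fun u v => Rcol v u); apply: Rcol_family. Qed.

Lemma Rpoly_rec u v s : s \in S -> inv v s -> Rpoly S u v =
  if inv u s then Rpoly S (u * s)%g (v * s)%g
  else 'X * Rpoly S (u * s)%g (v * s)%g + ('X - 1) * Rpoly S u (v * s)%g.
Proof.
move=> Ss Dv; have [_ _ recR] := Rpoly_family.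
by rewrite (recR u v s) !right_descentE Ss // Dv.
Qed.

Lemma Rpoly1 u : Rpoly S u 1%g = (u == 1%g)%:R.
Proof.
have [suppR diagR _] := Rpoly_family.
by have [-> // | neq] := eqVneq u 1%g; rewrite suppR // bruhat1r.
Qed.

Lemma RpolyE u v : Rpoly S u v = Rcol v u.
Proof.
elim/descent_ind: v u => [|v s Ss Dv IHv] u; first by rewrite Rpoly1 Rcol1 ffunE.
by rewrite (Rpoly_rec _ Ss Dv) (Rcol_rec Ss Dv) opDE !IHv.
Qed.

(** * The kernel identity *)

Definition eps w : {poly int} := (-1) ^+ ell w.

Lemma eps_mulS w s : s \in S -> eps (w * s)%g = - eps w.
Proof.
move=> Ss; rewrite /eps -signr_odd odd_ell_mulT ?gen_refl // -[RHS]mulN1r.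
by rewrite -exprS -[RHS]signr_odd.
Qed.

Lemma eps_sq w : eps w * eps w = 1.
Proof. by rewrite /eps -expr2 sqrr_sign. Qed.

Lemma opT_Rcol v s : s \in S -> opT s (Rcol v) =
  if inv v s then 'X *: Rcol (v * s)%g
  else Rcol (v * s)%g - ('X - 1) *: Rcol v.
Proof.
move=> Ss; have [Dv | Uv] := boolP (inv v s).
  by rewrite {1}(Rcol_rec Ss Dv) opT_opD.
have Dvs : inv (v * s)%g s by rewrite inv_mulgS.
by rewrite (Rcol_rec Ss Dvs) mulSK // /opD addrK.
Qed.

(** The matrix of the columns [Rcol] is inverse to its conjugate by the signs:
    multiplying the column of [w s] by [opT s] on one side and by [opD s] on
    the other gives opposite results. *)
Lemma Rcol_kernel u w :
  \sum_v eps v * Rcol v u * Rcol w v = eps w * (u == w)%:R.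
Proof.
elim/descent_ind: w u => [|w s Ss Dw IHw] u.
  rewrite (bigD1 1%g) //= big1 => [|v /negbTE neq_v]; rewrite Rcol1 !ffunE ?eqxx.
    by rewrite addr0 mulr1.
  by rewrite neq_v mulr0.
(* The right-hand side is turned into [opT s] applied to the identity for
   [w']. *)
set w' := (w * s)%g in IHw *; have Uw' : ~~ inv w' s by rewrite inv_mulgS ?Dw.
have -> : eps w * (u == w)%:R = - opT s (eps w' *: delta w') u.
  rewrite lin_scale; last exact: lin_opT.
  by rewrite opT_delta // mulSK // !ffunE scale_regE eps_mulS // mulNr opprK.
have <- : \sum_v (eps v * Rcol w' v) *: Rcol v = eps w' *: delta w'.
  apply/ffunP => x; rewrite sum_ffunE !ffunE -[RHS]IHw; apply: eq_bigr => v _.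
  by rewrite !ffunE scale_regE mulrAC.
rewrite (lin_sum _ _ _ (lin_opT s)) sum_ffunE -sumrN.
under eq_bigr do rewrite (Rcol_rec Ss Dw) opDE -/w'.
(* The two branches of the recursion are split into a term in [v s], to be
   reindexed by [v -> v s], and a term in [v]. *)
pose c (v : gT) : {poly int} := if inv v s then 1 else 'X.
pose d (v : gT) : {poly int} := if inv v s then 0 else 'X - 1.
transitivity (\sum_v eps v * Rcol v u * (c v * Rcol w' (v * s)%g)
  + \sum_v eps v * Rcol v u * (d v * Rcol w' v)).
  rewrite -big_split; apply: eq_bigr => v _ /=; rewrite /c /d.
  by case: inv; ring.
rewrite (reindex_inj (mulIg s)) -big_split /=; apply: eq_bigr => v _.
rewrite eps_mulS // mulSK // opT_Rcol // !ffunE scale_regE /c /d inv_mulgS //.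
by case: inv => /=; rewrite !ffunE ?scale_regE; ring.
Qed.

(** * Reversed polynomials *)

Lemma coef_rev d (p : {poly int}) i :
  (rev_poly d p)`_i = if (i <= d)%N then p`_(d - i) else 0.
Proof. by rewrite coef_poly ltnS. Qed.

Lemma size_rev_poly d (p : {poly int}) : (size (rev_poly d p) <= d.+1)%N.
Proof. exact: size_poly. Qed.

Lemma rev_polyD d (p1 p2 : {poly int}) :
  rev_poly d (p1 + p2) = rev_poly d p1 + rev_poly d p2.
Proof. by apply/polyP => i; rewrite coefD !coef_rev coefD; case: ifP; rewrite ?addr0. Qed.

Lemma rev_polyZ d c (p : {poly int}) : rev_poly d (c *: p) = c *: rev_poly d p.
Proof. by apply/polyP => i; rewrite coefZ !coef_rev coefZ; case: ifP; rewrite ?mulr0. Qed.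

Lemma rev_poly0 d : rev_poly d 0 = 0.
Proof. by rewrite -(scale0r (0 : {poly int})) rev_polyZ !scale0r. Qed.

Lemma rev_polyN d (p : {poly int}) : rev_poly d (- p) = - rev_poly d p.
Proof. by rewrite -scaleN1r rev_polyZ scaleN1r. Qed.

Lemma rev_poly_sum d (I : Type) (r : seq I) (P : pred I) (F : I -> {poly int}) :
  rev_poly d (\sum_(i <- r | P i) F i) = \sum_(i <- r | P i) rev_poly d (F i).
Proof. by apply: (big_morph _ (rev_polyD d) (rev_poly0 d)). Qed.

(** By linearity it is enough to treat a power of q as the first factor. *)
Lemma rev_polyM d e (p1 p2 : {poly int}) :
  (size p1 <= d.+1)%N -> (size p2 <= e.+1)%N ->
  rev_poly (d + e) (p1 * p2) = rev_poly d p1 * rev_poly e p2.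
Proof.
move=> sz1 sz2; have revXM j : (j <= d)%N ->
    rev_poly (d + e) ('X^j * p2) = 'X^(d - j) * rev_poly e p2.
  move=> le_jd; apply/polyP => i; rewrite coefXnM !coef_rev coefXnM.
  have [lt_id | le_di] := ltnP i (d - j).
    rewrite (_ : (i <= d + e)%N); last by lia.
    by rewrite ifN ?nth_default //; [apply: leq_trans sz2 _ | ]; lia.
  have [le_i | lt_i] := leqP i (d + e).
    have [lt_j | le_j] := ltnP (d + e - i) j.
      by rewrite ifN //; lia.
    by rewrite ifT; [congr (p2`_ _)|]; lia.
  by rewrite ifN //; lia.
have def_p1 : p1 = \sum_(j < d.+1) p1`_j *: 'X^j.
  apply/polyP => i; rewrite -poly_def coef_poly; case: ltnP => // le_i.
  by rewrite nth_default // (leq_trans sz1).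
have -> : rev_poly d p1 = \sum_(j < d.+1) p1`_j *: 'X^(d - j).
  rewrite /rev_poly poly_def (reindex_inj rev_ord_inj); apply: eq_bigr => j _ /=.
  by rewrite subSS subKn // -ltnS.
rewrite {1}def_p1 !mulr_suml rev_poly_sum; apply: eq_bigr => j _.
by rewrite -!scalerAl rev_polyZ revXM // -ltnS.
Qed.

(** The symmetry of an R-polynomial of a pair of length difference [d]. It bounds
    the degree by [d], since a reversed polynomial has degree at most [d]. *)
Definition skew d (p : {poly int}) := rev_poly d p == (-1) ^+ d *: p.

Lemma skew_size d p : skew d p -> (size p <= d.+1)%N.
Proof.
move=> /eqP eq_p; have -> : p = (-1) ^+ d *: rev_poly d p.
  by rewrite eq_p scalerA -expr2 sqrr_sign scale1r.
exact: leq_trans (size_scale_leq _ _) (size_rev_poly d p).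
Qed.

Lemma skewM d e p1 p2 : skew d p1 -> skew e p2 -> skew (d + e) (p1 * p2).
Proof.
move=> sk1 sk2; rewrite /skew rev_polyM ?skew_size // (eqP sk1) (eqP sk2).
by rewrite -scalerAl -scalerAr scalerA -exprD.
Qed.

Lemma skewD d p1 p2 : skew d p1 -> skew d p2 -> skew d (p1 + p2).
Proof. by rewrite /skew rev_polyD => /eqP-> /eqP->; rewrite scalerDr. Qed.

Lemma rev_poly1 : rev_poly 0 1 = 1.
Proof. by apply/polyP => i; rewrite coef_rev !coef1; case: i. Qed.

Lemma skew_1 : skew 0 1.
Proof. by rewrite /skew rev_poly1 expr0 scale1r. Qed.

Lemma skew_X : skew 2 'X.
Proof.
apply/eqP/polyP => i; rewrite coef_rev coefZ !coefX expr2 mulN1r opprK mul1r.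
by case: i => [|[|[|i]]].
Qed.

Lemma skew_X1 : skew 1 ('X - 1).
Proof.
apply/eqP/polyP => i; rewrite coef_rev coefZ !coefB !coefX !coef1 expr1 mulN1r opprB.
by case: i => [|[|i]].
Qed.

Lemma Rcol_skew u v : le u v -> skew (ell v - ell u) (Rcol v u).
Proof.
elim/descent_ind: v u => [|v s Ss Dv IHv] u.
  by rewrite bruhat1r Rcol1 ffunE => /eqP->; rewrite eqxx subnn skew_1.
rewrite (bruhat_rec u Ss Dv) (Rcol_rec Ss Dv) opDE /down.
have ell_v := ell_descent Ss Dv.
have [Du | Uu] := boolP (inv u s).
  by move=> /IHv; rewrite ell_v (ell_descent Ss Du) subSS.
move=> le_u; have := bruhat_ell_le le_u => le_ell.
apply: skewD; last first.
  by rewrite ell_v subSn // -addn1 addnC; apply: skewM skew_X1 (IHv _ le_u).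
have [le_us | nle_us] := boolP (le (u * s)%g (v * s)%g).
  have := bruhat_ell_le le_us; rewrite (ell_ascent Ss Uu) => lt_ell.
  have -> : (ell v - ell u = 2 + (ell (v * s)%g - ell (u * s)%g))%N.
    by rewrite (ell_ascent Ss Uu) ell_v; lia.
  exact: skewM skew_X (IHv _ le_us).
by rewrite Rcol_supp // mulr0 /skew rev_poly0 scaler0.
Qed.

(** * Kazhdan-Lusztig polynomials *)

(** The part of degree less than d / 2. *)
Definition lowhalf d (p : {poly int}) : {poly int} := \poly_(i < uphalf d) p`_i.

(** An antisymmetric polynomial has no middle coefficient, and its upper half is
    determined by the lower one. *)
Lemma lowhalf_rev d (p : {poly int}) : rev_poly d p = - p ->
  rev_poly d (- lowhalf d p) = - lowhalf d p + p.
Proof.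
move=> rev_p; have coef_p i : p`_i = - (rev_poly d p)`_i.
  by rewrite rev_p coefN opprK.
apply/polyP => i; rewrite rev_polyN coefN coefD coefN !coef_rev !coef_poly.
have := coef_p i; rewrite coef_rev.
have [le_id | lt_di] := leqP i d; last first.
  by rewrite oppr0 => ->; rewrite addr0 if_same oppr0.
have [lt_d | le_d] := ltnP (d - i) (uphalf d); have [lt_i | le_i] := ltnP i (uphalf d).
- by lia.
- by move=> ->; rewrite oppr0 add0r.
- by rewrite addNr oppr0.
have -> : (d - i = i)%N by lia.
by move: (p`_i) => c eq_c; rewrite oppr0 add0r; lia.
Qed.

(** The recursion on the length difference, with [k] as fuel: the coefficients of
    degree below d / 2 of the defining equation determine the polynomial from
    those of the pairs (a, v) with [u < a]. *)
Fixpoint KLfix k u v : {poly int} :=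
  if k is k'.+1 then
    if u == v then 1 else
    if le u v then
      - lowhalf (ell v - ell u) (\sum_(a | a != u) Rcol a u * KLfix k' a v)
    else 0
  else 0.

Lemma KLfix_supp k u v : ~~ le u v -> KLfix k u v = 0.
Proof.
case: k => //= k; case: eqP => [->|_ /negbTE->//].
by rewrite bruhat_refl.
Qed.

Lemma KLfix_stable k1 k2 u v : (ell v - ell u < k1)%N -> (ell v - ell u < k2)%N ->
  KLfix k1 u v = KLfix k2 u v.
Proof.
elim: k1 k2 u => // k1 IHk [|k2] u //= lt1 lt2; case: eqP => // _.
have [le_uv|//] := boolP (le u v); congr (- lowhalf _ _).
apply: eq_bigr => a neq_a.
have [le_ua | nle_ua] := boolP (le u a); last by rewrite Rcol_supp ?mul0r.
have [le_av | nle_av] := boolP (le a v); last by rewrite !KLfix_supp.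
have [eq_ua | lt_ua] := bruhat_ell le_ua; first by rewrite eq_ua eqxx in neq_a.
by have le_va := bruhat_ell_le le_av; rewrite (IHk k2) //; lia.
Qed.

Definition KLsol u v := KLfix (ell v - ell u).+1 u v.

(** The sum in the defining equation without its term at [u]. *)
Definition KLtail u v := \sum_(a | a != u) Rcol a u * KLsol a v.

Lemma KLsol_rec u v : le u v -> u != v ->
  KLsol u v = - lowhalf (ell v - ell u) (KLtail u v).
Proof.
move=> le_uv neq_uv; rewrite /KLsol /= (negPf neq_uv) le_uv; congr (- lowhalf _ _).
apply: eq_bigr => a neq_a.
have [le_ua | nle_ua] := boolP (le u a); last by rewrite Rcol_supp ?mul0r.
have [le_av | nle_av] := boolP (le a v); last by rewrite /KLsol !KLfix_supp.
have [eq_ua | lt_ua] := bruhat_ell le_ua; first by rewrite eq_ua eqxx in neq_a.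
have le_va := bruhat_ell_le le_av; congr (_ * _); apply: KLfix_stable; lia.
Qed.

Lemma KLsol_supp u v : ~~ le u v -> KLsol u v = 0.
Proof. exact: KLfix_supp. Qed.

Lemma KLsol_diag u : KLsol u u = 1.
Proof. by rewrite /KLsol /= eqxx. Qed.

Lemma KLsol_size u v : le u v -> u != v ->
  (size (KLsol u v) <= uphalf (ell v - ell u))%N.
Proof. by move=> le_uv neq_uv; rewrite KLsol_rec // size_polyN size_poly. Qed.

Lemma KLsol_size_le u v : le u v -> (size (KLsol u v) <= (ell v - ell u).+1)%N.
Proof.
move=> le_uv; have [-> | neq] := eqVneq u v; first by rewrite KLsol_diag size_poly1.
by apply: leq_trans (KLsol_size le_uv neq) _; lia.
Qed.

Lemma KLsol_sum u v : \sum_a Rcol a u * KLsol a v = KLsol u v + KLtail u v.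
Proof. by rewrite (bigD1 u) //= Rcol_diag mul1r. Qed.

Lemma eps_sub u v : le u v -> (-1) ^+ (ell v - ell u) = eps u * eps v :> {poly int}.
Proof.
move=> /bruhat_ell_le le_uv; rewrite /eps -{2}(subnK le_uv) exprD mulrCA -[(-1) ^+ ell u * _]expr2.
by rewrite sqrr_sign mulr1.
Qed.

(** By [lowhalf_rev] it remains to see that [KLtail u v] is antisymmetric.
    Reversing it reverses the R-polynomials up to sign and, by induction, turns
    the Kazhdan-Lusztig polynomials into sums; the double sum is then collapsed
    by [Rcol_kernel]. *)
Lemma KLsol_rev u v : le u v ->
  rev_poly (ell v - ell u) (KLsol u v) = \sum_a Rcol a u * KLsol a v.
Proof.
have [k] := ubnP (ell v - ell u); elim: k u => // k IHk u lt_k le_uv.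
have [<- | neq_uv] := eqVneq u v.
  rewrite KLsol_sum subnn KLsol_diag /KLtail big1 => [|a neq_a].
    by rewrite addr0 rev_poly1.
  have [le_ua | ?] := boolP (le u a); last by rewrite Rcol_supp ?mul0r.
  have [le_au | ?] := boolP (le a u); last by rewrite KLsol_supp ?mulr0.
  by rewrite (bruhat_anti le_ua le_au) eqxx in neq_a.
rewrite KLsol_sum KLsol_rec // lowhalf_rev //.
transitivity (\sum_(a | a != u) eps u * (eps a * Rcol a u) * \sum_b Rcol b a * KLsol b v).
  rewrite rev_poly_sum; apply: eq_bigr => a neq_a.
  have [le_ua | ?] := boolP (le u a); last first.
    by rewrite Rcol_supp // mul0r rev_poly0 !mulr0 mul0r.
  have [le_av | nle_av] := boolP (le a v); last first.
    rewrite KLsol_supp // mulr0 rev_poly0 big1 ?mulr0 // => b _.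
    have [le_ab | ?] := boolP (le a b); last by rewrite Rcol_supp ?mul0r.
    rewrite KLsol_supp ?mulr0 //; apply: contra nle_av.
    exact: bruhat_trans.
  have [eq_ua | lt_ua] := bruhat_ell le_ua; first by rewrite eq_ua eqxx in neq_a.
  have le_va := bruhat_ell_le le_av.
  have -> : (ell v - ell u = (ell a - ell u) + (ell v - ell a))%N by lia.
  have sk := Rcol_skew le_ua.
  rewrite rev_polyM; [|exact: skew_size sk|exact: KLsol_size_le].
  have /eqP eq_rev := sk; rewrite eq_rev IHk //; last by lia.
  rewrite -mul_polyC rmorphXn /= polyCN polyC1 eps_sub //.
  by rewrite [eps u * (_ * _)]mulrA.
pose f a b := eps a * Rcol a u * Rcol b a.
transitivity (eps u * \sum_b (\sum_(a | a != u) f a b) * KLsol b v).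
  under [in RHS]eq_bigr do rewrite mulr_suml.
  rewrite exchange_big mulr_sumr; apply: eq_bigr => a _ /=.
  rewrite -mulrA mulr_sumr; congr (_ * _); apply: eq_bigr => b _.
  by rewrite /f mulrA.
have sum_f b : \sum_(a | a != u) f a b = eps b * (u == b)%:R - eps u * Rcol b u.
  by rewrite -Rcol_kernel [in RHS](bigD1 u) //= Rcol_diag mulr1 addrAC subrr add0r.
under eq_bigr do rewrite sum_f mulrBl.
rewrite sumrB mulrBr (bigD1 u) //= eqxx big1 => [|b /negbTE neq_b]; last first.
  by rewrite eq_sym neq_b mulr0 mul0r.
rewrite mulr1 addr0 mulrA eps_sq mul1r.
under eq_bigr do rewrite -mulrA.
rewrite -mulr_sumr mulrA eps_sq mul1r KLsol_sum.
by rewrite opprD addrA subrr add0r.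
Qed.

Lemma sum_interval u v (P : gT -> gT -> {poly int}) :
  (forall a, ~~ le a v -> P a v = 0) ->
  \sum_(a | le u a && le a v) Rpoly S u a * P a v = \sum_a Rcol a u * P a v.
Proof.
move=> suppP; rewrite big_mkcond; apply: eq_bigr => a _; rewrite RpolyE.
have [le_ua | ?] := boolP (le u a); last by rewrite Rcol_supp ?mul0r.
by have [//| ?] := boolP (le a v); rewrite suppP ?mulr0.
Qed.

Lemma KLsol_family : is_KL_family S KLsol.
Proof.
split; [exact: KLsol_supp | exact: KLsol_diag | |] => u v le_uv.
  move=> neq_uv; have := KLsol_size le_uv neq_uv.
  by case: (bruhat_ell le_uv) neq_uv => [->|]; [rewrite eqxx | lia].
by rewrite KLsol_rev // sum_interval // => a; apply: KLsol_supp.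
Qed.

Lemma KLpoly_family : is_KL_family S (KLpoly S).
Proof. by apply: epsilon_spec; exists KLsol; apply: KLsol_family. Qed.

(** The degree bound and the symmetry of the difference of two solutions leave
    no room for a nonzero coefficient. *)
Lemma KL_family_unique P1 P2 : is_KL_family S P1 -> is_KL_family S P2 ->
  forall u v, P1 u v = P2 u v.
Proof.
move=> [supp1 diag1 deg1 rec1] [supp2 diag2 deg2 rec2] u v.
have [k] := ubnP (ell v - ell u); elim: k u => // k IHk u lt_k.
have [le_uv | nle_uv] := boolP (le u v); last by rewrite supp1 ?supp2.
have [<- | neq_uv] := eqVneq u v; first by rewrite diag1 diag2.
set d := (ell v - ell u)%N in lt_k.
have eq_tail : \sum_(a | a != u) Rcol a u * P1 a v = \sum_(a | a != u) Rcol a u * P2 a v.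
  apply: eq_bigr => a neq_a.
  have [le_ua | ?] := boolP (le u a); last by rewrite Rcol_supp ?mul0r.
  have [le_av | ?] := boolP (le a v); last by rewrite supp1 ?supp2.
  have [eq_ua | lt_ua] := bruhat_ell le_ua; first by rewrite eq_ua eqxx in neq_a.
  by have le_va := bruhat_ell_le le_av; rewrite IHk //; rewrite /d in lt_k; lia.
have eq_rev : rev_poly d (P1 u v - P2 u v) = P1 u v - P2 u v.
  rewrite rev_polyD rev_polyN rec1 ?rec2 //.
  rewrite (sum_interval u (supp1^~ v)) (sum_interval u (supp2^~ v)).
  rewrite (bigD1 u) //= [X in _ - X](bigD1 u) //= Rcol_diag !mul1r eq_tail.
  by rewrite opprD addrACA subrr addr0.
have low (P : gT -> gT -> {poly int}) i :
    (2 * (size (P u v)).-1 <= d.-1)%N -> (d <= 2 * i)%N -> (P u v)`_i = 0.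
  move=> deg_P le_d; apply: nth_default.
  have d_gt0 : (0 < d)%N.
    by rewrite subn_gt0; case: (bruhat_ell le_uv) neq_uv => [->|//]; rewrite eqxx.
  by move: (size (P u v)) deg_P => m deg_m; lia.
apply/subr0_eq/polyP => i; rewrite coef0.
have low12 j : (d <= 2 * j)%N -> (P1 u v - P2 u v)`_j = 0.
  by move=> le_d; rewrite coefB !low ?subr0 ?deg1 ?deg2.
have [/low12 // | lt_i] := leqP d (2 * i).
by rewrite -eq_rev coef_rev; case: leqP => // le_i; rewrite low12 //; lia.
Qed.

End CoxeterTheory.

(** * Inversions of signed permutations *)

Section SignedPermutations.

Variable m : nat.
Implicit Types (u v w x s t : symB m) (p : letter m) (i j : 'I_m).

(** The odd map on {-n..-1, 1..n} that extends the word of [w]. *)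
Definition act w p : letter m := (p.1 (+) (w p.2).1, (w p.2).2).

Definition neg p : letter m := (~~ p.1, p.2).

(** The position of a letter in the order -m < .. < -1 < 1 < .. < m. *)
Definition key p : nat := if p.1 then m.-1 - p.2 else m + p.2.

Lemma wordBP u v : (forall j, u j = v j) -> u = v.
Proof. by move=> eq_uv; apply/val_inj/ffunP. Qed.

Lemma act_word w j : act w (false, j) = w j.
Proof. by rewrite /act addFb -surjective_pairing. Qed.

Lemma wordM u v j : (u * v) j = act u (v j).
Proof. by rewrite ffunE. Qed.

Lemma actM u v p : act (u * v) p = act u (act v p).
Proof. by rewrite /act wordM /act /= addbA. Qed.

Lemma word1 j : (1 : symB m) j = (false, j).
Proof. by rewrite ffunE. Qed.

Lemma act1 p : act 1 p = p.
Proof. by case: p => b j; rewrite /act word1 /= addbF. Qed.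

Lemma act_neg w p : act w (neg p) = neg (act w p).
Proof. by rewrite /act /neg /= addNb. Qed.

Lemma actK w : cancel (act w) (act w^-1).
Proof. by move=> p; rewrite -actM mulVg act1. Qed.

Lemma act_inj w : injective (act w).
Proof. exact: can_inj (actK w). Qed.

Lemma actP u v : (forall p, act u p = act v p) -> u = v.
Proof. by move=> eq_uv; apply: wordBP => j; have := eq_uv (false, j); rewrite !act_word. Qed.

Lemma key_inj : injective key.
Proof.
move=> [b i] [c j]; have := (ltn_ord i, ltn_ord j); rewrite /key /= => -[lt_i lt_j].
move=> eq_k; have [-> /val_inj-> //] : b = c /\ val i = val j.
by case: b c eq_k => -[] /= ?; split; lia.
Qed.

Lemma key_neg p p' : (key (neg p) < key (neg p')) = (key p' < key p).
Proof.
case: p p' => [b i] [c j]; have := (ltn_ord i, ltn_ord j).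
by rewrite /key /neg /= => -[lt_i lt_j]; case: b; case: c => /=; lia.
Qed.

Lemma ord_pred_val i : 0 < i -> ord_pred i = i.-1 :> nat.
Proof.
move=> i_gt0 /=; have lt_i := ltn_ord i.
by rewrite -(prednK i_gt0) addSn /= -{2}(modn_small (leq_ltn_trans (leq_pred i) lt_i)) modnDr.
Qed.

Lemma act_simple i p : act (simpleB i) p =
  if i == 0 :> nat then (p.1 (+) (p.2 == i), p.2) else (p.1, tperm (ord_pred i) i p.2).
Proof.
by rewrite /act ffunE /simpleB_word; case: ifP => //; rewrite addbF.
Qed.

Lemma word_simple i j : simpleB i j =
  if i == 0 :> nat then (j == i, j) else (false, tperm (ord_pred i) i j).
Proof. by rewrite ffunE. Qed.

Lemma gen_step s p : s \in gensB m ->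
  key (act s p) <= (key p).+1 /\ key p <= (key (act s p)).+1.
Proof.
case/imsetP=> i _ ->; case: p => [b j]; rewrite act_simple.
have := (ltn_ord i, ltn_ord j) => -[lt_i lt_j].
have [i0 | i_neq0] := eqVneq (i : nat) 0.
  rewrite /key /=; have [eq_j | _] := eqVneq j i; last by rewrite addbF; split; lia.
  by rewrite addbT eq_j; case: b => /=; lia.
have i_gt0: 0 < i by rewrite lt0n.
move: (ord_pred i) (ord_pred_val i_gt0) => i' pred_i; rewrite /key /=.
by case: tpermP => [->|->|_ _]; case: b; lia.
Qed.

(** The letters that a reflection moves are those of an exchanged pair and of the
    opposite pair, which may coincide with it. *)
Definition pairlike t := forall p p', act t p != p -> act t p' != p' ->
  p' \in [:: p; act t p; neg p; neg (act t p)].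

Lemma gen_invol s : s \in gensB m -> s * s = 1.
Proof.
case/imsetP=> i _ ->; apply: actP => -[b j]; rewrite actM act1 !act_simple /=.
by case: (_ == 0) => /=; rewrite ?tpermK // -addbA addbb addbF.
Qed.

Lemma gen_pairlike s : s \in gensB m -> pairlike s.
Proof.
case/imsetP=> i _ -> [b j] [c k]; rewrite !act_simple /neg !inE !xpair_eqE /=.
case: ifP => _ /=; rewrite !xpair_eqE ?eqxx ?andbT /=.
  have [->|_] := eqVneq j i; last by rewrite addbF eqxx.
  have [_|_] := eqVneq k i; last by rewrite addbF eqxx.
  by case: b; case: c.
by do 2![case: tpermP => [->|->|]]; rewrite ?eqxx //; case: b; case: c; rewrite /= ?orbT.
Qed.

Lemma refl_pairlike t : t \in reflections (gensB m) -> pairlike t.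
Proof.
case/imset2P=> s x Ss _ -> p p'.
rewrite -[p](actK x) -[p'](actK x); move: (act x p) (act x p') => r r'.
have actJ q : act (s ^ x) (act x^-1 q) = act x^-1 (act s q).
  by rewrite /conjg -!actM -!mulgA mulgV mulg1.
rewrite !actJ !inE -!act_neg !(inj_eq (@act_inj x^-1)) => mv mv'.
by have := gen_pairlike Ss mv mv'; rewrite !inE -!act_neg.
Qed.

Lemma refl_invol t : t \in reflections (gensB m) -> t * t = 1.
Proof. by case/imset2P=> s x Ss _ ->; rewrite -conjMg gen_invol ?conj1g. Qed.

Lemma gen_neq1 s : s \in gensB m -> s != 1.
Proof.
case/imsetP=> i _ ->; apply/eqP => s1.
have := act_simple i (false, i); rewrite s1 act1.
case: ifP => [_ [] | /negbT i_neq0 [] /=]; first by rewrite eqxx.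
rewrite tpermR => /(congr1 (@nat_of_ord m)); rewrite ord_pred_val; first by lia.
by rewrite lt0n.
Qed.

Lemma refl_neq1 t : t \in reflections (gensB m) -> t != 1.
Proof. by case/imset2P=> s x Ss _ ->; rewrite conjg_eq1 gen_neq1. Qed.

Lemma refl_up t : t \in reflections (gensB m) -> exists p, key p < key (act t p).
Proof.
move=> Tt; have /existsP[p] : [exists p, act t p != p].
  apply: contraR (refl_neq1 Tt); rewrite negb_exists => /forallP fix_t.
  by apply/eqP/actP => p; rewrite act1; apply/eqP; have := fix_t p; rewrite negbK.
rewrite -(inj_eq key_inj) neq_ltn => /orP[lt_p|]; last by exists p.
by exists (act t p); rewrite -actM refl_invol // act1.
Qed.

(** A reflection also exchanges the pair opposite to a given one and fixes all
    other letters. *)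
Lemma refl_eq t1 t2 p :
    t1 \in reflections (gensB m) -> t2 \in reflections (gensB m) ->
  act t1 p = act t2 p -> act t1 p != p -> t1 = t2.
Proof.
move=> T1 T2 eq_p mv1; have mv2 : act t2 p != p by rewrite -eq_p.
have inv_t t r : t \in reflections (gensB m) -> act t (act t r) = r.
  by move=> Tt; rewrite -actM refl_invol ?act1.
have agree r : r \in [:: p; act t1 p; neg p; neg (act t1 p)] -> act t1 r = act t2 r.
  rewrite !inE => /or4P[] /eqP->; rewrite ?act_neg ?inv_t //.
  - by rewrite eq_p inv_t.
  - by rewrite eq_p.
  by rewrite eq_p inv_t.
apply: actP => r.
have [fix1 | mv1r] := eqVneq (act t1 r) r; last exact/agree/refl_pairlike.
have [fix2 | mv2r] := eqVneq (act t2 r) r; first by rewrite fix1 fix2.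
by apply: agree; rewrite eq_p; apply: refl_pairlike.
Qed.

Definition invB w t :=
  [exists p, (key p < key (act t p)) && (key (act w (act t p)) < key (act w p))].

(** The only other pair that [t] may exchange is the opposite one, and odd maps
    invert a pair and its opposite together. *)
Lemma invB_pair w t p : t \in reflections (gensB m) -> key p < key (act t p) ->
  invB w t = (key (act w (act t p)) < key (act w p)).
Proof.
move=> Tt lt_p; apply/existsP/idP => [[r /andP[lt_r lt_w]] | lt_w]; last first.
  by exists p; rewrite lt_p.
have mv q : key q < key (act t q) -> act t q != q.
  by move=> lt_q; apply: contraTneq lt_q => ->; rewrite ltnn.
have inv_t q : act t (act t q) = q by rewrite -actM refl_invol ?act1.
have := refl_pairlike Tt (mv _ lt_p) (mv _ lt_r).
rewrite !inE => /or4P[] /eqP r_def; move: lt_r lt_w; rewrite r_def ?act_neg ?inv_t ?key_neg //.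
- by rewrite ltnNge ltnW.
- by rewrite ltnNge ltnW.
Qed.

Lemma incr_ord_id (f : 'I_m -> nat) :
  (forall i j, j = i.+1 :> nat -> f i < f j) -> (forall i, f i < m) -> forall i, f i = i.
Proof.
move=> f_incr f_lt i; apply/eqP; rewrite eqn_leq; apply/andP; split.
  have [k] := ubnP (m - i); elim: k i => // k IHk i lt_k.
  have [lt_i | le_i] := ltnP i.+1 m; last first.
    by have := f_lt i; have := ltn_ord i; lia.
  have := f_incr i (Ordinal lt_i) erefl.
  by have /= := IHk (Ordinal lt_i); lia.
case: i => i; elim: i => //= i IHi lt_i.
have lt_i' := ltnW lt_i; apply: leq_ltn_trans (IHi lt_i') _.
exact: f_incr.
Qed.

Lemma invB_simple w i : invB w (simpleB i) =
  if i == 0 :> nat then (w i).1 else key (w i) < key (w (ord_pred i)).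
Proof.
have Ti : simpleB i \in reflections (gensB m).
  by rewrite mem_class_support ?imset_f.
have lt_i := ltn_ord i; case: ifP => [i0 | /negbT i_neq0].
  have act_i : act (simpleB i) (true, i) = (false, i).
    by rewrite act_simple i0 /= eqxx.
  rewrite (invB_pair w Ti (_ : key (true, i) < _)) act_i; last first.
    by rewrite /key /=; lia.
  rewrite (_ : (true, i) = neg (false, i)) // act_neg act_word.
  by have := ltn_ord (w i).2; rewrite /key /neg /=; case: (w i).1 => /=; lia.
have i_gt0 : 0 < i by rewrite lt0n.
have act_i : act (simpleB i) (false, ord_pred i) = (false, i).
  by rewrite act_simple (negPf i_neq0) /= tpermL.
rewrite (invB_pair w Ti (_ : key (false, ord_pred i) < _)) act_i ?act_word //.
by move: (ord_pred i) (ord_pred_val i_gt0) => i' pred_i; rewrite /key /=; lia.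
Qed.

(** For [t] different from [s], the simple reflection [s] maps a pair exchanged
    by [t] to one exchanged by [s t s] and keeps its order, because [s] reverses
    only the pairs that it exchanges itself. For [t = s] the two values of [w]
    are exchanged. *)
Lemma cocycleB : inversion_cocycle (gensB m) invB.
Proof.
split=> [s Ss | t Tt | w s t Ss Tt | w].
- exact: gen_invol.
- have [p lt_p] := refl_up Tt; rewrite (invB_pair _ Tt lt_p) !act1.
  by rewrite -leqNgt ltnW.
- have Ts : s \in reflections (gensB m) by rewrite mem_class_support.
  have [-> | nts] := eqVneq t s.
    rewrite /conjg invgK mulgA mulgK; have [p lt_p] := refl_up Ts.
    rewrite !(invB_pair _ Ts lt_p) !actM -!(actM s s) gen_invol // act1.
    rewrite addbT -leqNgt [RHS]leq_eqVlt (inj_eq key_inj) (inj_eq (@act_inj w)).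
    by have [eq_p | //] := eqVneq p (act s p); rewrite -eq_p ltnn in lt_p.
  have [p lt_p] := refl_up Tt.
  have act_t' : act (t ^ s^-1) (act s p) = act s (act t p).
    by rewrite /conjg invgK !actM actK.
  have Tt' : t ^ s^-1 \in reflections (gensB m).
    case/imset2P: Tt => r x Sr _ ->.
    by rewrite -conjgM memJ_class_support ?inE.
  rewrite addbF (invB_pair _ Tt lt_p) (invB_pair _ Tt' (_ : key (act s p) < _)) act_t'.
    by rewrite !actM.
  rewrite ltnNge leq_eqVlt negb_or (inj_eq key_inj) (inj_eq (@act_inj s)).
  rewrite -(inj_eq key_inj) neq_ltn lt_p orbT /=; apply/negP => lt_s.
  have [le1 _] := gen_step p Ss; have [_ le2] := gen_step (act t p) Ss.
  (* Letters move by at most one step, so a reversed pair is adjacent and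
     exchanged by [s]. *)
  have eq_sp : act s p = act t p by apply: key_inj; lia.
  case/eqP: nts; apply/esym/(refl_eq Ts Tt eq_sp).
  by rewrite eq_sp -(inj_eq key_inj) neq_ltn lt_p orbT.
move=> w_neq1; have /exists_inP[s Ss Dw] : [exists s in gensB m, invB w s].
  apply: contraR w_neq1 => /exists_inPn no_desc.
  have asc i : ~~ invB w (simpleB i) by apply: no_desc; rewrite imset_f.
  have w_pos i : (w i).1 = false /\ (forall j, j = i.+1 :> nat -> (w i).2 < (w j).2).
    have [k] := ubnP (i : nat); elim: k i => // k IHk i lt_k.
    have pos_i : (w i).1 = false.
      have := asc i; rewrite invB_simple; case: ifP => [_ /negbTE // | /negbT i_neq0].
      have i_gt0: 0 < i by rewrite lt0n.
      have [|pos_j _] := IHk (ord_pred i); first by rewrite ord_pred_val //; lia.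
      rewrite /key pos_j; have := ltn_ord (w i).2.
      by case: (w i).1 => //; lia.
    split=> // j ij; have := asc j; rewrite invB_simple ij /=.
    have -> : ord_pred j = i by apply: ord_inj; rewrite ord_pred_val ij.
    have neq_ij : (w i).2 != (w j).2.
      by rewrite (inj_eq (@wordB_inj _ w)) -val_eqE /= ij; lia.
    rewrite /key pos_i; have := ltn_ord (w i).2; have := ltn_ord (w j).2.
    by move: neq_ij; rewrite -val_eqE /=; case: (w j).1; lia.
  have w_id := @incr_ord_id (fun i => (w i).2) (fun i j => (w_pos i).2 j) (fun i => ltn_ord _).
  apply/eqP/wordBP => i; rewrite word1 [LHS]surjective_pairing (w_pos i).1.
  by congr pair; apply: val_inj; apply: w_id.
by exists s.
Qed.

End SignedPermutations.

(** * Inversions of permutations *)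

Section Permutations.

Variable n : nat.
Implicit Types (x y t : symA n) (i : 'I_n).

Lemma emb_inj_subproof x : injective (fun j => ((false, wordA x j) : letter n.+1).2).
Proof. by move=> j k /= /perm_inj. Qed.

(** Permutations of {0, .., n} are the signed permutations of n + 1 letters
    without signs, and A_n is a parabolic subgroup of B_(n+1). *)
Definition embA x : symB n.+1 := mkB (@emb_inj_subproof x).

Lemma embAE x j : embA x j = (false, wordA x j).
Proof. by rewrite ffunE. Qed.

Lemma wordAM x y j : wordA (x * y) j = wordA x (wordA y j).
Proof. exact: permM. Qed.

Lemma wordA1 j : wordA (1 : symA n) j = j.
Proof. exact: perm1. Qed.

Lemma wordA_inj x : injective (wordA x).
Proof. exact: perm_inj. Qed.

Lemma wordAP x y : (forall j, wordA x j = wordA y j) -> x = y.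
Proof. by move=> eq_xy; apply/permP. Qed.

Lemma embAM x y : embA (x * y) = embA x * embA y.
Proof. by apply: wordBP => j; rewrite wordM !embAE /act embAE wordAM. Qed.

Lemma embA1 : embA 1 = 1.
Proof. by apply: wordBP => j; rewrite word1 embAE wordA1. Qed.

Lemma embAV x : embA x^-1 = (embA x)^-1.
Proof. by apply/esym/eqP; rewrite eq_invg_mul -embAM mulgV embA1. Qed.

Lemma embA_inj : injective embA.
Proof.
move=> x y eq_xy; apply: wordAP => j.
by have := embAE x j; rewrite eq_xy embAE => -[].
Qed.

Lemma embAJ x y : embA (x ^ y) = embA x ^ embA y.
Proof. by rewrite /conjg !embAM embAV. Qed.

Lemma embA_simple i : embA (simpleA i) = simpleB (lift ord0 i).
Proof.
apply: wordBP => j; rewrite embAE ffunE /simpleB_word /= /wordA.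
congr (_, tperm _ _ _); apply: ord_inj.
by rewrite ord_pred_val.
Qed.

Lemma embA_gen s : s \in gensA n -> embA s \in gensB n.+1.
Proof. by case/imsetP=> i _ ->; rewrite embA_simple imset_f. Qed.

Lemma embA_refl t : t \in reflections (gensA n) -> embA t \in reflections (gensB n.+1).
Proof.
by case/imset2P=> s x Ss _ ->; rewrite embAJ memJ_class_support ?inE ?embA_gen.
Qed.

Definition invA x t := invB (embA x) (embA t).

Lemma invA_simple x i :
  invA x (simpleA i) = (wordA x (lift ord0 i) < wordA x (widen_ord (leqnSn n) i)).
Proof.
rewrite /invA embA_simple invB_simple /= !embAE /key /= ltn_add2l.
congr (_ < wordA x _); apply: ord_inj.
by rewrite ord_pred_val.
Qed.

Lemma cocycleA : inversion_cocycle (gensA n) invA.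
Proof.
have [invol inv1 invM _] := cocycleB n.+1.
split=> [s Ss | t Tt | x s t Ss Tt | x].
- by apply: embA_inj; rewrite embAM invol ?embA_gen ?embA1.
- by rewrite /invA embA1 inv1 ?embA_refl.
- by rewrite /invA embAM invM ?embA_gen ?embA_refl // embAJ embAV (inj_eq embA_inj).
move=> x_neq1; have /exists_inP[s Ss Dx] : [exists s in gensA n, invA x s].
  apply: contraR x_neq1 => /exists_inPn no_desc.
  apply/eqP/wordAP => j; rewrite wordA1; apply: val_inj.
  apply: (@incr_ord_id _ (fun j => wordA x j)) => // {}j k jk.
  have lt_j : j < n by rewrite -ltnS -jk ltn_ord.
  have := no_desc (simpleA (Ordinal lt_j)); rewrite imset_f // invA_simple.
  have -> : lift ord0 (Ordinal lt_j) = k by apply: val_inj; rewrite /= jk.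
  have -> : widen_ord (leqnSn n) (Ordinal lt_j) = j by apply: val_inj.
  move=> /(_ isT); rewrite -leqNgt leq_eqVlt val_eqE (inj_eq (@wordA_inj x)).
  by rewrite -val_eqE /= jk; case: eqP => // eq_j; lia.
by exists s.
Qed.

End Permutations.

(** * The bottom map *)

Section BottomMap.

Variable n : nat.
Implicit Types (x y z a : symA n) (u v w : symB n) (i j k : 'I_n).

Notation gA := (gensA n).
Notation gB := (gensB n).
Notation sA := (@simpleA n).
Notation sB := (@simpleB n).
Notation cA := (@cocycleA n).
Notation cB := (@cocycleB n).

Lemma sA_gen i : sA i \in gA. Proof. exact: imset_f. Qed.
Lemma sB_gen i : sB i \in gB. Proof. exact: imset_f. Qed.

Lemma bot_pos x j k : wordA x (lift ord0 j) = lift ord0 k -> bot x j = (false, k).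
Proof. by move=> xj; rewrite ffunE /bot_word xj liftK. Qed.

Lemma bot_neg x j k : wordA x (lift ord0 j) = ord0 -> wordA x ord0 = lift ord0 k ->
  bot x j = (true, k).
Proof. by move=> xj x0; rewrite ffunE /bot_word xj x0 unlift_none liftK. Qed.

Variant bot_spec x j : letter n -> Type :=
  | BotPos k of wordA x (lift ord0 j) = lift ord0 k : bot_spec x j (false, k)
  | BotNeg k of wordA x (lift ord0 j) = ord0 & wordA x ord0 = lift ord0 k :
      bot_spec x j (true, k).

Lemma botP x j : bot_spec x j (bot x j).
Proof.
case: (unliftP ord0 (wordA x (lift ord0 j))) => [k xj | xj].
  by rewrite (bot_pos xj); constructor.
case: (unliftP ord0 (wordA x ord0)) => [k x0 | x0].
  by rewrite (bot_neg xj x0); constructor.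
have /wordA_inj/eqP := etrans xj (esym x0).
by rewrite eq_sym (negPf (neq_lift _ _)).
Qed.

Lemma bot_sign x j : (bot x j).1 = (wordA x (lift ord0 j) == ord0).
Proof.
case: botP => [k -> | k -> _] /=; last by rewrite eqxx.
by rewrite eq_sym (negPf (neq_lift _ _)).
Qed.

Lemma bot1 : bot (1 : symA n) = 1.
Proof. by apply: wordBP => j; rewrite word1 (@bot_pos _ _ j) ?wordA1. Qed.

Lemma bot_key_lt x j k : j != k ->
  (key (bot x j) < key (bot x k)) = (wordA x (lift ord0 j) < wordA x (lift ord0 k)).
Proof.
move=> neq_jk; case: botP => [a -> | a xj x0]; case: botP => [b -> | b xk x0'];
  rewrite /key /= ?xj ?xk /=; try by have := (ltn_ord a, ltn_ord b) => -[]; rewrite /bump; lia.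
by have /wordA_inj/lift_inj/eqP := etrans xj (esym xk); rewrite (negPf neq_jk).
Qed.

Lemma widen_lift i : 0 < i -> widen_ord (leqnSn n) i = lift ord0 (ord_pred i).
Proof.
move=> i_gt0; apply: ord_inj; rewrite lift0 ord_pred_val //=.
by rewrite prednK.
Qed.

Lemma widen_0 i : i = 0 :> nat -> widen_ord (leqnSn n) i = ord0.
Proof. by move=> i0; apply: ord_inj; rewrite /= i0. Qed.

Lemma simpleA_lift i j : 0 < i ->
  wordA (sA i) (lift ord0 j) = lift ord0 (tperm (ord_pred i) i j).
Proof.
move=> i_gt0; rewrite /wordA /simpleA widen_lift //.
by rewrite (inj_tperm _ _ _ (@lift_inj _ ord0)).
Qed.

Lemma simpleA_ord0 i : 0 < i -> wordA (sA i) ord0 = ord0.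
Proof.
by move=> i_gt0; rewrite /wordA /simpleA widen_lift // tpermD // eq_sym neq_lift.
Qed.

(** Condition on [x] under which right multiplication by the i-th simple
    reflection commutes with [bot]. Exchanging positions 0 and 1 amounts to a
    change of sign in [bot x] only if the entry 0 is involved. *)
Definition compat x i :=
  [|| 0 < i, wordA x ord0 == ord0 | wordA x (lift ord0 i) == ord0].

Lemma bot_mul_ascent x i : i = 0 :> nat -> wordA x ord0 = ord0 ->
  bot (x * sA i) = bot x * sB i.
Proof.
move=> i0 x0; apply: wordBP => j; rewrite wordM word_simple i0 /=.
have x_pos k : exists l, wordA x (lift ord0 k) = lift ord0 l.
  case: (unliftP ord0 (wordA x (lift ord0 k))) => [l ->|xk]; first by exists l.
  have /wordA_inj/eqP := etrans xk (esym x0).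
  by rewrite eq_sym (negPf (neq_lift _ _)).
have [l xj] := x_pos j; rewrite /act /= (bot_pos xj) /= addbF.
have [eq_ji | neq_ji] := eqVneq j i.
  apply: bot_neg; rewrite wordAM /wordA /simpleA widen_0 //.
    by rewrite eq_ji tpermR.
  by rewrite tpermL -eq_ji.
apply: bot_pos; rewrite wordAM -xj; congr (wordA x _).
by rewrite /wordA /simpleA widen_0 // tpermD ?neq_lift // (inj_eq (@lift_inj _ ord0)) eq_sym.
Qed.

Lemma bot_mul x i : compat x i -> bot (x * sA i) = bot x * sB i.
Proof.
have [i0 | i_gt0] := posnP i; rewrite /compat.
  rewrite i0 /= => /orP[/eqP | /eqP xi]; first exact: bot_mul_ascent.
  have := @bot_mul_ascent (x * sA i) i i0; rewrite (mulSK cA _ (sA_gen i)) => ->.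
    by rewrite (mulSK cB _ (sB_gen i)).
  by rewrite wordAM /wordA /simpleA widen_0 // tpermL.
move=> _; apply: wordBP => j; rewrite wordM word_simple gtn_eqF // act_word.
have xs0 : wordA (x * sA i) ord0 = wordA x ord0 by rewrite wordAM simpleA_ord0.
have xsj : wordA (x * sA i) (lift ord0 j) = wordA x (lift ord0 (tperm (ord_pred i) i j)).
  by rewrite wordAM simpleA_lift.
case: (botP x (tperm _ _ _)) => [k xk | k xk x0]; first by apply: bot_pos; rewrite xsj.
by apply: bot_neg; rewrite ?xsj ?xs0.
Qed.

Lemma bot_inv x i : compat x i -> invB (bot x) (sB i) = invA x (sA i).
Proof.
rewrite invB_simple invA_simple /compat; have [i0 | i_gt0] := posnP i.
  rewrite /= bot_sign widen_0 // => /orP[] /eqP eq0.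
    rewrite eq0 ltn0; apply/eqP => xi; have /wordA_inj/eqP := etrans xi (esym eq0).
    by rewrite eq_sym (negPf (neq_lift _ _)).
  rewrite eq0 eqxx lt0n; apply/esym/eqP => /= x0.
  have /wordA_inj/eqP : wordA x ord0 = wordA x (lift ord0 i) by rewrite eq0; apply: ord_inj.
  by rewrite (negPf (neq_lift _ _)).
move=> _; rewrite bot_key_lt ?widen_lift //.
by apply/eqP => /(congr1 (@nat_of_ord n)); rewrite ord_pred_val //; lia.
Qed.

(** If no descent of [y] is at positions 1 to n, then the entries increase from
    position 1 on. A descent at position 0 excludes the entry 0 there, so this
    smallest entry is in position 1. *)
Lemma compat_descent y : y != 1 -> exists2 i, compat y i & invA y (sA i).
Proof.
move=> y_neq1; have [s /imsetP[i _ ->] Dy] := has_inv cA y_neq1.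
have [/existsP[k /andP[k_gt0 Dk]] | noD] :=
    boolP [exists k : 'I_n, (0 < k) && invA y (sA k)].
  by exists k; rewrite /compat ?k_gt0.
have [i_gt0 | i_le0] := ltnP 0 i.
  by case/existsP: noD; exists i; rewrite i_gt0.
exists i => //; rewrite /compat.
move: Dy; rewrite invA_simple widen_0; last by lia.
move=> lt_y; have [j y_j] : exists j, wordA y (lift ord0 j) = ord0.
  case: (unliftP ord0 (invg (y : 'S_n.+1) ord0)) => [j yj | y0].
    by exists j; rewrite -yj /wordA permKV.
  have : wordA y ord0 = ord0 by rewrite -y0 /wordA permKV.
  by move=> y00; rewrite y00 ltn0 in lt_y.
suff -> : i = j by rewrite y_j eqxx !orbT.
apply: ord_inj; have [j_gt0 | ] := ltnP 0 j; last by lia.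
case/existsP: noD; exists j; rewrite j_gt0 invA_simple y_j widen_lift //= lt0n.
apply/eqP => y0.
have /wordA_inj/lift_inj :
    wordA y (lift ord0 (ord_pred j)) = wordA y (lift ord0 j).
  by rewrite y_j; apply: ord_inj.
by move=> /(congr1 (@nat_of_ord n)); rewrite ord_pred_val //; lia.
Qed.

Lemma bot_ind (P : symA n -> Prop) : P 1 ->
  (forall y i, compat y i -> invA y (sA i) -> P (y * sA i) -> P y) ->
  forall y, P y.
Proof.
move=> P1 Pstep y; have [k] := ubnP (ell gA y); elim: k y => // k IHk y lt_k.
have [-> // | /compat_descent[i ci Dy]] := eqVneq y 1.
by apply: (Pstep _ i) => //; apply: IHk; rewrite -ltnS -(ell_descent cA (sA_gen i) Dy).
Qed.

Lemma ell_bot x : ell gB (bot x) = ell gA x.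
Proof.
elim/bot_ind: x => [|x i ci Dx IHx]; first by rewrite bot1 (ell1 cA) (ell1 cB).
rewrite (ell_descent cA (sA_gen i) Dx) -IHx bot_mul //.
by apply: (ell_descent cB (sB_gen i)); rewrite bot_inv.
Qed.

Lemma bot_eq1 x : (bot x == 1) = (x == 1).
Proof.
have [-> | /compat_descent[i ci Dx]] := eqVneq x 1; first by rewrite bot1 eqxx.
apply/eqP => bot_x; rewrite -bot_inv // bot_x in Dx.
by rewrite (inv1 cB) ?gen_refl ?sB_gen in Dx.
Qed.

(** Both sets generate the symmetric group on 1, .., n, as a parabolic subgroup of
    A_n and of B_n. *)
Definition parA : {set symA n} := [set sA i | i : 'I_n & 0 < i].
Definition parB : {set symB n} := [set sB i | i : 'I_n & 0 < i].

Lemma parA_sub : parA \subset gA.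
Proof. by apply/subsetP => _ /imsetP[i _ ->]; apply: sA_gen. Qed.

Lemma parB_sub : parB \subset gB.
Proof. by apply/subsetP => _ /imsetP[i _ ->]; apply: sB_gen. Qed.

Lemma parA_fix0 a : a \in <<parA>> -> wordA a ord0 = ord0.
Proof.
have gr : group_set [set x : symA n | wordA x ord0 == ord0].
  apply/group_setP; split=> [|x y]; first by rewrite inE wordA1.
  by rewrite !inE wordAM => /eqP x0 /eqP ->; rewrite x0.
have sub : <<parA>> \subset Group gr.
  rewrite gen_subG; apply/subsetP => _ /imsetP[i i_gt0 ->].
  by rewrite inE simpleA_ord0 //; rewrite inE in i_gt0.
by move=> /(subsetP sub); rewrite inE => /eqP.
Qed.

Lemma parB_pos w j : w \in <<parB>> -> (w j).1 = false.
Proof.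
have gr : group_set [set w : symB n | [forall j, ~~ (w j).1]].
  apply/group_setP; split=> [|u v]; first by rewrite inE; apply/forallP => k; rewrite word1.
  rewrite !inE => /forallP pu /forallP pv; apply/forallP => k; rewrite wordM /act /=.
  by rewrite (negPf (pv k)) (negPf (pu _)).
have sub : <<parB>> \subset Group gr.
  rewrite gen_subG; apply/subsetP => _ /imsetP[i i_gt0 ->].
  rewrite inE in i_gt0; rewrite inE; apply/forallP => k.
  by rewrite word_simple gtn_eqF.
by move=> /(subsetP sub); rewrite inE => /forallP/(_ j)/negPf.
Qed.

Lemma bot_pos_fix0 x : (forall j, (bot x j).1 = false) -> wordA x ord0 = ord0.
Proof.
move=> pos_x; case: (unliftP ord0 (invg (x : 'S_n.+1) ord0)) => [j xj | x0].
  by have := pos_x j; rewrite bot_sign -xj /wordA permKV eqxx.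
by rewrite -x0 /wordA permKV.
Qed.

Lemma fix0_par a : wordA a ord0 = ord0 -> a \in <<parA>> /\ bot a \in <<parB>>.
Proof.
elim/bot_ind: a => [|a i ci Da IHa] a0; first by rewrite bot1 !group1.
have [i0 | i_gt0] := posnP i.
  by move: Da; rewrite invA_simple widen_0 // a0 ltn0.
have [] := IHa; first by rewrite wordAM simpleA_ord0.
have pAi : sA i \in <<parA>> by rewrite mem_gen // imset_f // inE.
have pBi : sB i \in <<parB>> by rewrite mem_gen // imset_f // inE.
by rewrite bot_mul // !groupMr.
Qed.

(** Here [i] is 0 and [y s'_0] lies in the parabolic subgroup, which is a lower
    set. If [x] were below [y], then [x] or [x s'_0] would fix 0, so that 0 is
    one of the first two entries of [x]. In B_n, [bot x] has no descent at s_0,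
    and would therefore have no negative entry. *)
Lemma incompat_not_le x y i : compat y i -> invA y (sA i) -> ~~ compat x i ->
  ~~ bruhat gA x y /\ ~~ bruhat gB (bot x) (bot y).
Proof.
move=> cy Dy; rewrite /compat !negb_or -leqNgt leqn0 => /and3P[/eqP i0 nx0 nxi].
have ys0 : wordA (y * sA i) ord0 = ord0.
  rewrite wordAM /wordA /simpleA widen_0 // tpermL -/(wordA y).
  move: cy Dy; rewrite /compat invA_simple i0 /= widen_0 // => /orP[] /eqP // ->.
  by rewrite ltn0.
have [ysA ysB] := fix0_par ys0.
split; [rewrite (bruhat_rec cA x (sA_gen i) Dy)
       | rewrite (bruhat_rec cB (bot x) (sB_gen i)) ?bot_inv //].
  apply/negP => /(bruhat_parabolic cA parA_sub ysA)/parA_fix0 /eqP.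
  rewrite /down; case: ifP => _; last by rewrite (negPf nx0).
  by rewrite wordAM /wordA /simpleA widen_0 // tpermL -/(wordA x) (negPf nxi).
rewrite -bot_mul // /down invB_simple i0 /= bot_sign (negPf nxi).
apply/negP => /(bruhat_parabolic cB parB_sub ysB) pos_x.
by case/eqP: nx0; apply: bot_pos_fix0 => j; apply: parB_pos.
Qed.

(** For a compatible descent, the lifting property reduces the comparison with
    [y] to one with [y s], in the same way in both groups. *)
Lemma bruhat_bot x y : bruhat gB (bot x) (bot y) = bruhat gA x y.
Proof.
elim/bot_ind: y x => [|y i cy Dy IHy] x.
  by rewrite bot1 (bruhat1r cA) (bruhat1r cB) bot_eq1.
have [cx | ncx] := boolP (compat x i); last first.
  by have [/negPf-> /negPf->] := incompat_not_le cy Dy ncx.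
have DBy : invB (bot y) (sB i) by rewrite bot_inv.
rewrite (bruhat_rec cA x (sA_gen i) Dy) (bruhat_rec cB (bot x) (sB_gen i) DBy).
by rewrite -bot_mul // /down bot_inv //; case: ifP => _; rewrite -?bot_mul // IHy.
Qed.

Lemma bot_injective : injective (@bot n).
Proof.
move=> x y eq_xy; apply: (bruhat_anti cA); rewrite -bruhat_bot eq_xy; exact: bruhat_refl.
Qed.

(** The smaller of [u] and [u s] is below [bot (y s)], hence of the form [bot z].
    If [u] is [bot z] multiplied by s_0, then [z] is in the parabolic subgroup
    with [y s'_0], so that [u] is [bot (z s'_0)]. *)
Lemma bot_lower y u : bruhat gB u (bot y) -> exists x, u = bot x.
Proof.
elim/bot_ind: y u => [|y i cy Dy IHy] u.
  by rewrite bot1 (bruhat1r cB) => /eqP->; exists 1; rewrite bot1.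
have DBy : invB (bot y) (sB i) by rewrite bot_inv.
rewrite (bruhat_rec cB u (sB_gen i) DBy) -bot_mul // => le_d.
have [z def_z] := IHy _ le_d; move: def_z le_d; rewrite /down.
case: ifP => _ def_z; last by exists z.
have def_u : u = bot z * sB i by rewrite -def_z (mulSK cB) ?sB_gen.
rewrite def_z bruhat_bot => le_z; exists (z * sA i); rewrite bot_mul //.
apply: contraT => ncz; have ys0 : wordA (y * sA i) ord0 = ord0.
  move: ncz; rewrite /compat !negb_or -leqNgt leqn0 => /and3P[/eqP i0 _ _].
  rewrite wordAM /wordA /simpleA widen_0 // tpermL -/(wordA y).
  move: cy Dy; rewrite /compat invA_simple i0 /= widen_0 // => /orP[] /eqP // ->.
  by rewrite ltn0.
have [ysA _] := fix0_par ys0.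
have := parA_fix0 (bruhat_parabolic cA parA_sub ysA le_z).
by move: ncz; rewrite /compat !negb_or => /and3P[_ /eqP].
Qed.

Lemma lower_bot x : lower_interval gB (bot x) = @bot n @: lower_interval gA x.
Proof.
apply/setP => u; rewrite inE; apply/idP/imsetP => [le_u | [y]].
  by have [y def_u] := bot_lower le_u; exists y => //; rewrite inE -bruhat_bot -def_u.
by rewrite inE -bruhat_bot => le_y ->.
Qed.

Lemma interval_bot x : poset_iso (bruhat gA) (bruhat gB)
  (lower_interval gA x) (lower_interval gB (bot x)).
Proof.
exists (@bot n); split=> [y z _ _ /bot_injective // | | y z _ _].
  by rewrite lower_bot.
exact: bruhat_bot.
Qed.

Lemma poincare_bot x : poincare gA x = poincare gB (bot x).
Proof.
rewrite /poincare lower_bot big_imset /=; last by move=> y z _ _ /bot_injective.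
by apply: eq_bigr => y _; rewrite ell_bot.
Qed.

Lemma Rpoly_bot x y : Rpoly gA x y = Rpoly gB (bot x) (bot y).
Proof.
elim/bot_ind: y x => [|y i cy Dy IHy] x.
  by rewrite bot1 (Rpoly1 cA) (Rpoly1 cB) bot_eq1.
have [cx | ncx] := boolP (compat x i); last first.
  have [nA nB] := incompat_not_le cy Dy ncx.
  by have [[suppA _ _] [suppB _ _]] := (Rpoly_family cA, Rpoly_family cB); rewrite suppA ?suppB.
have DBy : invB (bot y) (sB i) by rewrite bot_inv.
rewrite (Rpoly_rec cA _ (sA_gen i) Dy) (Rpoly_rec cB _ (sB_gen i) DBy).
by rewrite -!bot_mul // bot_inv // !IHy.
Qed.

(** The polynomials of B_n, pulled back along [bot], satisfy the characterization
    of those of A_n. *)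
Lemma KLpoly_bot x y : KLpoly gA x y = KLpoly gB (bot x) (bot y).
Proof.
apply: (KL_family_unique cA (P2 := fun x y => KLpoly gB (bot x) (bot y))).
  exact: KLpoly_family cA.
have [suppB diagB degB recB] := KLpoly_family cB.
split=> [u v | u | u v | u v].
- by rewrite -bruhat_bot; apply: suppB.
- exact: diagB.
- by rewrite -!ell_bot -bruhat_bot -(inj_eq bot_injective); apply: degB.
rewrite -!ell_bot -bruhat_bot => le_uv; rewrite recB //.
pose L := [set a | bruhat gA u a && bruhat gA a v].
transitivity (\sum_(b in @bot n @: L) Rpoly gB (bot u) b * KLpoly gB b (bot v))%R.
  apply: eq_bigl => b; apply/idP/imsetP => [/andP[le_ub le_bv] | [a]].
    have [a def_b] := bot_lower le_bv; exists a => //.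
    by rewrite inE -!bruhat_bot -def_b le_ub.
  by rewrite inE -!bruhat_bot => le_a ->.
rewrite big_imset /=; last by move=> a b _ _ /bot_injective.
by apply: eq_big => [a | a _]; rewrite ?inE // Rpoly_bot.
Qed.

End BottomMap.

Theorem corollary1p3 (n : nat) (hn : (1 <= n)%N) :
  (* (i) *)
  ((forall x : symA n,
      poset_iso (bruhat (gensA n)) (bruhat (gensB n))
        (lower_interval (gensA n) x) (lower_interval (gensB n) (bot x)))
   /\
   (forall x : symA n, exists w : symB n,
      poset_iso (bruhat (gensA n)) (bruhat (gensB n))
        (lower_interval (gensA n) x) (lower_interval (gensB n) w)))
  /\
  (* (ii) *)
  ((forall x : symA n,
      poincare (gensA n) x = poincare (gensB n) (bot x))
   /\
   (forall x : symA n, exists w : symB n,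
      poincare (gensA n) x = poincare (gensB n) w))
  /\
  (* (iii) *)
  ((forall x y : symA n, bruhat (gensA n) x y ->
      KLpoly (gensA n) x y = KLpoly (gensB n) (bot x) (bot y))
   /\
   (forall x y : symA n, bruhat (gensA n) x y ->
      exists u v : symB n, bruhat (gensB n) u v /\
        KLpoly (gensA n) x y = KLpoly (gensB n) u v)).
Proof.
split; [|split]; split=> x.
- exact: interval_bot.
- by exists (bot x); apply: interval_bot.
- exact: poincare_bot.
- by exists (bot x); apply: poincare_bot.
- by move=> y _; apply: KLpoly_bot.
move=> y le_xy; exists (bot x), (bot y).
by rewrite bruhat_bot KLpoly_bot.
Qed.
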